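(* Let $\rho\in(0,+\infty)$ and let $\Pi_\rho:=[0,1]\times[0,\rho]^3\times[-\rho,0]$. Assume the following conditions hold. (a) $f:\Pi_\rho\to\mathbb{R}$ is continuous and there exists a continuous function $\underline{\delta}_\rho:[0,1]\to[0,+\infty)$ such that $$f(t,u,v,w,z)\ge \underline{\delta}_\rho(t)\quad\text{for every }(t,u,v,w,z)\in\Pi_\rho.$$ (b) $H:\overline{K}_\rho\to\mathbb{R}$ is continuous and bounded, and $\underline{\eta}_\rho\in[0,+\infty)$ is such that $$H[u]\ge\underline{\eta}_\rho\quad\text{for every }u\in\partial K_\rho.$$ (c) The inequality $$\underline{\eta}_\rho+\int_0^1\underline{\delta}_\rho(s)\,ds>0$$ holds. Then the boundary value problem $$\begin{cases}u^{(4)}(t)=\lambda f(t,u(t),u'(t),u''(t),u'''(t)),\quad t\in(0,1),\\ u(0)=u'(0)=u''(1)=0,\\ u'''(1)+\lambda H[u]=0,\end{cases}$$ has a positive eigenvalue $\lambda_\rho$ with an associated eigenfunction $u_\rho\in\partial K_\rho$.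
   Context: The space $C^3[0,1]$ of real-valued functions is endowed with the norm $\|u\|_3:=\max_{j=0,\ldots,3}\|u^{(j)}\|_\infty$, where $\|w\|_\infty=\sup_{t\in[0,1]}|w(t)|$. The cone $K$ is $$K:=\{u\in C^3[0,1]:\ u(t),\,u'(t),\,u''(t),\,-u'''(t)\ge 0\ \text{for every }t\in[0,1]\}.$$ For $\rho\in(0,+\infty)$ set $\overline{K}_\rho:=\{u\in K:\|u\|_3\le\rho\}$ and $\partial K_\rho:=\{u\in K:\|u\|_3=\rho\}$. Definition of eigenvalue: let $$k(t,s)=\begin{cases}\frac16(3t^2s-t^3), & s\ge t,\\ \frac16(3s^2t-s^3), & s\le t,\end{cases}\qquad \gamma(t)=\frac16(3t^2-t^3).$$ A number $\lambda$ is an eigenvalue of the boundary value problem with a corresponding eigenfunction $u\in C^3[0,1]$, $\|u\|_3>0$, if the pair $(u,\lambda)$ satisfies the perturbed Hammerstein integral equation $$u(t)=\lambda\Bigl(\gamma(t)H[u]+\int_0^1 k(t,s)f(s,u(s),u'(s),u''(s),u'''(s))\,ds\Bigr),\quad t\in[0,1].$$ *)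

(* Defs.v *)
From mathcomp Require Import all_boot all_order all_algebra.
From mathcomp Require Import all_classical all_reals all_analysis.

Set Implicit Arguments.
Unset Strict Implicit.
Unset Printing Implicit Defensive.

Import Order.TTheory GRing.Theory Num.Theory.
Import numFieldNormedType.Exports.

Local Open Scope classical_set_scope.
Local Open Scope ring_scope.

(* A function on [0,1] is represented by a total function R -> R of which only
   the restriction to [0,1] matters: every notion below ignores the values
   taken outside [0,1]. *)

Section DerivativesOnUnitInterval.
Context {R : realType}.
Implicit Types (u w : R -> R) (t : R) (j : nat).

Definition quotient01 u t : R -> R := fun s => (u s - u t) / (s - t).

(* The difference quotient tends to its limit along s in [0,1], s != t; at
   t = 0 and t = 1 this is the one-sided derivative. *)
Definition derivable01 u t : Prop :=
  cvg (quotient01 u t @ within `[0, 1] t^').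

Definition derive01 u : R -> R :=
  fun t => lim (quotient01 u t @ within `[0, 1] t^').

Definition derive01n j u : R -> R := iter j derive01 u.

(* Continuity of the derivatives of order < 3 follows from differentiability. *)
Definition C3 : set (R -> R) := [set u |
  (forall j t, (j < 3)%N -> 0 <= t <= 1 -> derivable01 (derive01n j u) t) /\
  {within `[0, 1], continuous (derive01n 3 u)}].

Definition norm_infty w : R := sup [set `|w t| | t in `[0, 1]].

Definition norm3 u : R := \big[Num.max/0]_(j < 4) norm_infty (derive01n j u).

End DerivativesOnUnitInterval.

Section Cone.
Context {R : realType}.
Implicit Types (rho : R).

Definition coneK : set (R -> R) := [set u | C3 u /\
  forall t, 0 <= t <= 1 ->
    [/\ 0 <= u t, 0 <= derive01n 1 u t, 0 <= derive01n 2 u t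
      & 0 <= - derive01n 3 u t]].

Definition coneK_ball rho : set (R -> R) :=
  [set u | coneK u /\ norm3 u <= rho].

Definition coneK_sphere rho : set (R -> R) :=
  [set u | coneK u /\ norm3 u = rho].

Definition Pi_box rho : set (R * R * R * R * R) :=
  `[0, 1] `*` `[0, rho] `*` `[0, rho] `*` `[0, rho] `*` `[- rho, 0].

(* Applied to functions that agree on [0,1], hence are at norm3-distance 0,
   this forces H u = H v: H is a functional of the restriction to [0,1]. *)
Definition norm3_continuous_on (A : set (R -> R)) (H : (R -> R) -> R) : Prop :=
  forall u, A u -> forall e, 0 < e -> exists2 d, 0 < d &
    forall v, A v -> norm3 (v \- u) < d -> `|H v - H u| < e.

Definition bounded_functional_on (A : set (R -> R)) (H : (R -> R) -> R) : Prop :=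
  exists M : R, forall u, A u -> `|H u| <= M.

End Cone.

Section Eigenvalue.
Context {R : realType}.
Implicit Types (t s lambda : R) (u : R -> R).

Definition kernel_k t s : R :=
  if t <= s then 6^-1 * (3 * t ^+ 2 * s - t ^+ 3)
  else 6^-1 * (3 * s ^+ 2 * t - s ^+ 3).

Definition gamma t : R := 6^-1 * (3 * t ^+ 2 - t ^+ 3).

(* lambda is an eigenvalue, with eigenfunction u, of the problem
     u'''' = lambda f(t, u, u', u'', u''')  on (0,1),
     u(0) = u'(0) = u''(1) = 0,  u'''(1) + lambda H[u] = 0,
   which by definition is read as its Hammerstein integral equation: gamma
   solves u'''' = 0, u(0) = u'(0) = u''(1) = 0, u'''(1) + 1 = 0, and kernel_k
   is the Green's function of u'''' with homogeneous boundary conditions. *)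
Definition bvp_eigenpair (f : R * R * R * R * R -> R) (H : (R -> R) -> R)
    lambda u : Prop :=
  [/\ C3 u, 0 < norm3 u &
    forall t, 0 <= t <= 1 ->
      u t = lambda * (gamma t * H u +
        \int[lebesgue_measure]_(s in `[0, 1])
          (kernel_k t s *
           f (s, u s, derive01n 1 u s, derive01n 2 u s, derive01n 3 u s)))].

End Eigenvalue.

(* Main.v *)
Require Import Defs.
From mathcomp Require Import all_boot all_order all_algebra.
From mathcomp Require Import all_classical all_reals all_analysis.
From mathcomp Require Import fingroup perm.
From mathcomp Require Import zify ring lra.
Import Order.TTheory GRing.Theory Num.Theory.
Import numFieldNormedType.Exports.
Local Open Scope classical_set_scope.
Local Open Scope ring_scope.

(** The unknown is taken to be [w = - u'''] instead of [u].  For continuous [w]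
    with values in [0, rho] let [lift0 w] be the function [u] with
    [u''' = - w] and [u(0) = u'(0) = u''(1) = 0].  Then
    [u''(t) = \int_t^1 w], and [u'], [u] are primitives of nonnegative functions
    on an interval of length 1, so each of [u], [u'], [u''] takes values in
    [0, rho].  Hence [u] lies in the cone, and [norm3 u = rho] as soon as
    [w 0 = rho] ([lift0_sphere]): the condition
    [norm3 u = rho], which does not define a convex set of functions [u], is met
    on a convex set of functions [w].

    Differentiating the Hammerstein equation three times turns it into
    [w(t) = lambda * (H u + \int_t^1 f(s, u, u', u'', u'''))].  Prescribing
    [w 0 = rho] determines [lambda], namely [lambda = rho / load w 0] where
    [load w t] is the factor of [lambda] above.  On the sphere
    [load w 0 >= eta + \int delta > 0], so the map
    [w |-> rho * load w / load w 0] is well defined and continuous for the sup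
    norm, keeps values in [0, rho], and has values that are Lipschitz with one
    common constant because [f] is bounded on the compact box.  A fixed point
    gives the eigenpair; going back from [w] to the integral equation is
    integration by parts against the Green's function ([green_identity]).

    The fixed point is Schauder's ([schauder_fixed_point]).  A function is
    replaced by its piecewise linear interpolation at the nodes [i / n], which
    reduces the question to Brouwer's theorem on a cube ([brouwer_cube]); the
    images of the approximate fixed points are equi-Lipschitz and a limit along
    an ultrafilter on [nat] is an exact fixed point.  Brouwer's theorem is in
    turn the limit of Kuhn's combinatorial lemma on finer and finer grids
    ([kuhn]), which is Sperner's parity argument on the triangulation of
    the cube grid indexed by base points and permutations. *)

Set Implicit Arguments.
Unset Strict Implicit.
Unset Printing Implicit Defensive.

(** * Kuhn's combinatorial lemma *)

Section Kuhn.
Import boot.fintype boot.finset.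
Local Open Scope set_scope.
Local Open Scope nat_scope.

Lemma involution_even (T : finType) (A : {set T}) (g : T -> T) :
  {in A, forall x, g x \in A} -> {in A, forall x, g (g x) = x} ->
  {in A, forall x, g x != x} -> ~~ odd #|A|.
Proof.
elim: {A}_.+1 {-2}A (ltnSn #|A|) => // c IH A cA gA gg gx.
have [->|[x xA]] := set_0Vmem A; first by rewrite cards0.
have gxA := gA x xA.
have gxD : g x \in A :\ x by rewrite !inE gx.
rewrite (cardsD1 x A) xA (cardsD1 (g x) (A :\ x)) gxD /= negbK.
have cB : #|A :\ x :\ g x| < c.
  by move: cA; rewrite (cardsD1 x A) xA (cardsD1 (g x) (A :\ x)) gxD /=; lia.
apply: IH => // y; rewrite !inE => /and3P[ygx yx yA]; rewrite ?gg ?gx ?gA // andbT.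
apply/andP; split; first by apply: contraNneq yx => /(congr1 g); rewrite !gg // => ->.
by apply: contraNneq ygx => <-; rewrite gg.
Qed.

Definition full k (lam : nat -> nat) :=
  [forall c : 'I_k.+1, exists j : 'I_k.+1, lam j == c].

Definition door k (lam : nat -> nat) (j : 'I_k.+1) :=
  [forall c : 'I_k, exists l : 'I_k.+1, (l != j) && (lam l == c)].

(** Sperner's count: if the labels of the [k + 1] vertices do not exceed [k],
    the facets whose labels exhaust [0, .., k - 1] number one when all labels
    occur, and otherwise none or two: the vertex opposite to such a facet then
    repeats the label of exactly one other vertex, and these two can be
    exchanged. *)
Lemma odd_doors k (lam : nat -> nat) : (forall j, j <= k -> lam j <= k) ->
  odd #|[set j | @door k lam j]| = full k lam.
Proof.
move=> lamk.
pose L (j : 'I_k.+1) : 'I_k.+1 := inord (lam j).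
have LE j : L j = lam j :> nat by rewrite inordK // ltnS lamk // -ltnS.
have fullP : full k lam = ([set L j | j in [set: 'I_k.+1]] == [set: 'I_k.+1]).
  apply/forallP/eqP => [h|/setP h c].
    apply/setP => c; rewrite inE; have /existsP[j /eqP jc] := h c.
    by apply/imsetP; exists j => //; apply: val_inj; rewrite /= LE.
  have := h c; rewrite inE => /imsetP[j _ cj]; apply/existsP; exists j.
  by rewrite cj LE.
have doorP j : door lam j = ([set~ ord_max] \subset [set L l | l in [set~ j]]).
  apply/forallP/subsetP => [h c|h c].
    rewrite !inE => cm; have ck : c < k.
      by rewrite ltn_neqAle -ltnS ltn_ord andbT; apply: contraNneq cm => ck;
         apply/eqP/val_inj.
    have /existsP[l /andP[lj /eqP lc]] := h (Ordinal ck).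
    by apply/imsetP; exists l; rewrite ?inE //; apply: val_inj; rewrite /= LE.
  have := h (widen_ord (leqnSn k) c); rewrite !inE.
  have -> : widen_ord (leqnSn k) c != ord_max.
    by rewrite -val_eqE /= neq_ltn ltn_ord.
  move=> /(_ isT)/imsetP[l]; rewrite !inE => lj /(congr1 val) /= cl.
  by apply/existsP; exists l; rewrite lj -LE -cl eqxx.
have cardC (j : 'I_k.+1) : #|[set~ j]| = k by rewrite cardsC1 card_ord.
have [fl|nfl] := boolP (full k lam).
  move: fl; rewrite fullP => /eqP imL.
  have Linj : injective L.
    have /imset_injP h : #|[set L j | j in [set: 'I_k.+1]]| == #|[set: 'I_k.+1]|.
      by rewrite imL.
    by move=> x y; apply: h; rewrite inE.
  have /imsetP[j0 _ j0m] : ord_max \in [set L j | j in [set: 'I_k.+1]] by rewrite imL inE.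
  suff -> : [set j : 'I_k.+1 | door lam j] = [set j0] by rewrite cards1.
  apply/setP => j; rewrite !inE doorP; apply/subsetP/eqP => [h|-> c].
    apply/eqP; apply: contraT => jj0.
    have Lj : L j \in [set~ ord_max].
      by rewrite !inE j0m; apply: contra_neq jj0; apply: Linj.
    have /imsetP[l] := h _ Lj; rewrite !inE => lj /Linj jl.
    by rewrite jl eqxx in lj.
  rewrite !inE => cm; have : c \in [set L j | j in [set: 'I_k.+1]] by rewrite imL inE.
  case/imsetP=> l _ cl; apply/imsetP; exists l => //; rewrite !inE.
  by apply: contra_neq cm => lj; rewrite cl lj j0m.
have [->|[j jd]] := set_0Vmem [set j : 'I_k.+1 | door lam j]; first by rewrite cards0.
move: (jd); rewrite inE doorP => sub.
have imC : [set L l | l in [set~ j]] = [set~ ord_max].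
  apply/esym/eqP; rewrite eqEcard sub /= cardC.
  by rewrite (leq_trans (leq_imset_card _ _)) // cardC.
have Linj : {in [set~ j] &, injective L}.
  by apply/imset_injP; rewrite imC !cardC.
have Ljm : L j != ord_max.
  apply: contra nfl => /eqP Ljm; rewrite fullP eqEsubset subsetT /=.
  apply/subsetP => c _; have [->|cm] := eqVneq c ord_max.
    by rewrite -Ljm imset_f.
  have : c \in [set~ ord_max] by rewrite !inE.
  by rewrite -imC => /imsetP[l _ ->]; rewrite imset_f.
have : L j \in [set~ ord_max] by rewrite !inE.
rewrite -imC => /imsetP[j' j'j Ljj'].
have jj' : j != j' by move: j'j; rewrite !inE eq_sym.
suff -> : [set j : 'I_k.+1 | door lam j] = [set j; j'] by rewrite cards2 jj'.
apply/setP => i; rewrite in_set doorP in_set2; apply/subsetP/idP => [h|].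
  apply: contraT; rewrite negb_or => /andP[ij ij'].
  have Li : L i \in [set~ ord_max] by rewrite -imC imset_f // !inE.
  have /imsetP[l] := h _ Li; rewrite !inE => li Lil.
  have [lj|lj] := eqVneq l j.
    have : i = j' by apply: Linj => //; rewrite ?inE // Lil lj.
    by move/eqP; rewrite (negPf ij').
  have : i = l by apply: Linj; rewrite ?inE.
  by move/eqP; rewrite eq_sym (negPf li).
case/orP => /eqP -> c cm; first by rewrite imC.
move: cm; rewrite -imC => /imsetP[l lj ->].
have [->|lj'] := eqVneq l j'; first by rewrite -Ljj' imset_f // !inE.
by rewrite imset_f // !inE.
Qed.

Variables (n m : nat).
Notation I := 'I_n.+1.
Notation simplex := ({ffun I -> 'I_m.+1} * 'S_n.+1)%type.
Implicit Types (s : simplex) (v : {ffun I -> nat}) (i : I).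

(** The simplex [(x, p)] of the Kuhn (Freudenthal) triangulation goes from the
    corner [x] to the opposite corner of its unit cube by raising the
    coordinates one at a time; [p i] is the position of [i] in that order. *)
Definition vertex (s : simplex) (j : nat) : {ffun I -> nat} :=
  [ffun i => s.1 i + (s.2 i < j)].

(** The [k]-dimensional simplices are kept inside the same type: they are the
    [(x, p)] that leave the coordinates of index at least [k] at zero and raise
    the first [k] coordinates first, so that only the vertices [0, .., k] matter.
    The induction on the dimension then needs no change of index type. *)
Definition subsimplex (k : nat) (s : simplex) : bool :=
  [forall i : I, (k <= i) ==> (s.1 i == ord0) && (s.2 i == i)].

Lemma subsimplexP k s :
  reflect (forall i : I, k <= i -> s.1 i = ord0 /\ s.2 i = i) (subsimplex k s).
Proof.
apply: (iffP forallP) => h i; first by move/(implyP (h i))/andP => [/eqP-> /eqP->].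
by apply/implyP => /h[-> ->]; rewrite !eqxx.
Qed.

Lemma subsimplex_pos k s (i : I) : subsimplex k s -> (s.2 i < k) = (i < k).
Proof.
move=> /subsimplexP h; apply/idP/idP; apply: contraLR; rewrite -!leqNgt.
  by move=> ki; have [_ ->] := h i ki.
by move=> ki; have [_ /perm_inj <-] := h _ ki.
Qed.

(** The cyclic shift of the positions [0, .., k]; it is the change of order when
    a simplex is left through its first vertex or its last one. *)
Definition cyc_fun (k i : I) : I :=
  if i < k then inord i.+1 else if i == k then ord0 else i.

Lemma cyc_funE (k i : I) : cyc_fun k i = (if i < k then i.+1 else if i == k then 0 else i) :> nat.
Proof.
rewrite /cyc_fun; case: ifP => [ik|_]; last by case: ifP.
by rewrite inordK //; apply: leq_ltn_trans ik _.
Qed.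

Lemma cyc_inj k : injective (cyc_fun k).
Proof.
move=> i j /(congr1 val) /=; rewrite !cyc_funE -!val_eqE /= => h.
by apply: val_inj => /=; move: h; repeat case: ifP; lia.
Qed.

Definition cyc k : 'S_n.+1 := perm (@cyc_inj k).

Lemma cycE (k i : I) :
  cyc k i = (if i < k then i.+1 else if i == k then 0 else i) :> nat.
Proof. by rewrite permE cyc_funE. Qed.

Lemma cyc_eq0 (k i : I) : (cyc k i == ord0) = (i == k).
Proof. by rewrite -!val_eqE /= cycE -val_eqE /=; repeat case: ifP; lia. Qed.

(** Leaving the simplex through the facet opposite to its first vertex leads to
    a neighbour whose vertices are the same up to a shift of the indices. *)
Lemma vertex_cyc (k : I) (x : {ffun I -> 'I_m.+1}) (q : 'S_n.+1) l : l <= k ->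
  (forall i, q i = k -> x i < m) ->
  vertex (x, (q * cyc k)%g) l.+1 =
  vertex ([ffun i => if q i == k then ordS (x i) else x i], q) l.
Proof.
move=> lk xm; apply/ffunP => i; rewrite !ffunE /= permM cycE.
case: ifP => [qk|qk]; first by rewrite -val_eqE /= ltn_eqF.
case: ifP => [/eqP qik|qik].
  by rewrite /= modn_small ?ltnS ?xm // qik; lia.
by move: qk qik; rewrite -val_eqE /=; lia.
Qed.

Variable b : {ffun I -> nat} -> I -> bool.
Hypothesis b0 : forall v i, v i = 0 -> ~~ b v i.
Hypothesis bm : forall v i, v i = m.+1 -> b v i.

(** The index of the first coordinate whose bit is off, and [n + 1] when all bits
    are on.  A vertex with label [i] has bit [i] off and one with label [n + 1]
    has every bit on, so a fully labelled simplex shows both values of every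
    bit. *)
Definition label (v : {ffun I -> nat}) : nat := find (fun i => ~~ b v i) (enum I).

Lemma label_le v (i : I) : ~~ b v i -> label v <= i.
Proof.
move=> bvi; rewrite leqNgt; apply/negP => /(before_find i) /=.
by rewrite nth_ord_enum bvi.
Qed.

Lemma label_eq v (i : I) : label v = i -> ~~ b v i.
Proof.
move=> li; have : has (fun i => ~~ b v i) (enum I).
  by rewrite has_find -/(label v) li size_enum_ord.
by move/(nth_find i); rewrite -/(label v) li nth_ord_enum.
Qed.

Lemma label_max v (i : I) : label v = n.+1 -> b v i.
Proof. by move=> lv; apply: contraT => /label_le; rewrite lv leqNgt ltn_ord. Qed.

Lemma label_le_max v : label v <= n.+1.
Proof. by rewrite /label (leq_trans (find_size _ _)) // size_enum_ord. Qed.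

Definition labels s j := label (vertex s j).

Lemma labels_le k s j : k <= n.+1 -> subsimplex k s -> j <= k -> labels s j <= k.
Proof.
rewrite leq_eqVlt => /orP[/eqP -> _ _|kn sk jk]; first exact: label_le_max.
apply: (@label_le _ (Ordinal kn)); apply: b0.
have /subsimplexP/(_ (Ordinal kn) (leqnn k))[x0 p0] := sk.
by rewrite ffunE x0 p0 /= ltnNge jk.
Qed.

(** Replaces a pair of a simplex and a vertex by the pair with the same opposite
    facet on the other side of it: the two adjacent steps around an inner vertex
    are exchanged, and for the two extreme vertices the order is rotated.  The
    base point moves cyclically, so that this is an involution with no
    exception; the wrapping only happens on the boundary of the grid. *)
Definition flip (k : I) (sj : simplex * 'I_k.+2) : simplex * 'I_k.+2 :=
  let: ((x, p), j) := sj in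
  if j == ord0 then
    (([ffun i => if p i == ord0 then ordS (x i) else x i], (p * (cyc k)^-1)%g),
     ord_max)
  else if j == ord_max then
    (([ffun i => if p i == k then ord_pred (x i) else x i], (p * cyc k)%g), ord0)
  else ((x, (p * tperm (inord j.-1) (inord j))%g), j).

Lemma flipK k : involutive (@flip k).
Proof.
case=> [[x p] j] /=; have [->|j0] := eqVneq j ord0.
  rewrite /= eqxx -mulgA mulVg mulg1.
  set x' := (X in (X, _, _)); suff -> : x' = x by [].
  apply/ffunP => i; rewrite !ffunE permM /= -cyc_eq0 permKV.
  by case: ifP => [/eqP ->|/eqP pi]; [rewrite eqxx; exact: ordSK|case: eqP].
have [->|jm] := eqVneq j ord_max.
  rewrite /= -mulgA mulgV mulg1.
  set x' := (X in (X, _, _)); suff -> : x' = x by [].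
  apply/ffunP => i; rewrite !ffunE permM /= cyc_eq0.
  by case: ifP => [/eqP ->|/eqP pi]; [rewrite eqxx; exact: ord_predK|case: eqP].
by rewrite /= (negPf j0) (negPf jm) -mulgA tperm2 mulg1.
Qed.

Lemma flip_neq k sj : @flip k sj != sj.
Proof.
case: sj => [[x p] j] /=; have [->|j0] := eqVneq j ord0.
  by apply/eqP => -[].
have [->|jm] := eqVneq j ord_max; first by apply/eqP => -[].
apply/eqP => -[] /(congr1 (mulg p^-1)); rewrite mulKg mulVg.
have jk : j < k.+1 by rewrite ltn_neqAle -ltnS ltn_ord andbT; exact: jm.
have jn : j < n.+1 by apply: leq_trans jk (ltn_ord k).
have j_gt0 : 0 < j by rewrite lt0n; exact: j0.
move=> /permP/(_ (inord j)); rewrite tpermR perm1 => /(congr1 val) /=.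
by rewrite !inordK //; move: j_gt0 jn; lia.
Qed.

Definition doors (k : I) : {set simplex * 'I_k.+2} :=
  [set sj | subsimplex k.+1 sj.1 && door (labels sj.1) sj.2].

(** The facets labelled [0, .., k] through which one leaves the grid: the
    boundary conditions on the bits rule out every face but the one where
    coordinate [k] vanishes, which is the grid of the next smaller dimension. *)
Definition boundary_doors (k : I) : {set simplex * 'I_k.+2} :=
  [set sj in doors k |
    [&& sj.2 == ord_max, sj.1.1 k == ord0 & sj.1.2 k == k]].

Lemma doorW k (lam lam' : nat -> nat) (j j' : 'I_k.+1) (g : 'I_k.+1 -> 'I_k.+1) :
  (forall l, l != j -> g l != j' /\ lam' (g l) = lam l) ->
  door lam j -> door lam' j'.
Proof.
move=> h /forallP d; apply/forallP => c.
have /existsP[l /andP[lj /eqP lc]] := d c.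
by have [gj gl] := h l lj; apply/existsP; exists (g l); rewrite gj gl lc eqxx.
Qed.

(** Apart from [boundary_doors] no wrapping occurs: a facet on the face where
    coordinate [i] is maximal misses label [i], and on the face where it vanishes
    all labels are at most [i], which excludes label [k] unless [i = k]. *)
Lemma flip_interior k sj :
  sj \in doors k :\: boundary_doors k -> flip sj \in doors k :\: boundary_doors k.
Proof.
case: sj => [[x p] j]; rewrite !inE /= => /andP[nbd /andP[sk dj]].
have kn := ltn_ord k.
rewrite sk dj /= in nbd; have /subsimplexP /= sk' := sk.
have labelE (i : I) : i <= k -> exists2 l : 'I_k.+2, l != j & labels (x, p) l = i.
  move=> ik; move/forallP: dj => /(_ (Ordinal (ik : i < k.+1))).
  by case/existsP => l /andP[lj /eqP e]; exists l.
have [j0|j0] := eqVneq j ord0.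
  rewrite /= j0 /= in dj labelE *.
  have pik i : p i = ord0 -> i <= k.
    by move=> pi0; rewrite -ltnS -(subsimplex_pos i sk) /= pi0.
  have xm i : p i = ord0 -> x i < m.
    move=> pi0; rewrite ltn_neqAle -ltnS ltn_ord andbT.
    apply/negP => /eqP xim; have [l l0 li] := labelE i (pik _ pi0).
    have : ~~ b (vertex (x, p) l) i by apply: label_eq; exact: li.
    rewrite bm // ffunE /= pi0 xim.
    by move: l0; rewrite -val_eqE /= -lt0n => ->; rewrite addn1.
  set x' := [ffun i => _]; set q := (p * _)%g.
  have pq : p = (q * cyc k)%g by rewrite /q -mulgA mulVg mulg1.
  have pqE i : (p i == ord0) = (q i == k) by rewrite pq permM cyc_eq0.
  have vE l : l <= k -> labels (x, p) l.+1 = labels (x', q) l.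
    move=> lk; rewrite /labels {1}pq vertex_cyc //; last first.
      by move=> i /eqP qk; apply: xm; apply/eqP; rewrite pqE.
    congr (label (vertex (_, _) _)); apply/ffunP => i.
    by rewrite !ffunE pqE.
  have -> /= : subsimplex k.+1 (x', q).
    apply/subsimplexP => i ki /=; have [x0 pi] := sk' i ki.
    rewrite ffunE pi; have i0 : i != ord0.
      by rewrite -val_eqE /=; apply: contraTneq ki => ->.
    rewrite (negPf i0) x0; split=> //; apply: (@perm_inj _ (cyc k)).
    rewrite -permM -pq pi; apply: val_inj; rewrite /= cycE -val_eqE /=.
    by move: ki; repeat case: ifP; lia.
  have -> /= : door (labels (x', q)) (ord_max : 'I_k.+2).
    apply: (doorW (g := fun l => inord l.-1)) dj => l.
    rewrite -!val_eqE /= => l0; have lk := ltn_ord l.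
    rewrite inordK; last by move: l0 lk; lia.
    split; first by move: l0 lk; lia.
    rewrite -vE; last by move: l0 lk; lia.
    by congr labels; move: l0; lia.
  rewrite andbT; apply/negP => /and3P[_ /eqP x'k /eqP qk].
  move: x'k; rewrite /x' ffunE pqE qk eqxx => /(congr1 val) /=.
  by rewrite modn_small ?ltnS // xm //; apply/eqP; rewrite pqE qk.
have [jm|jm] := eqVneq j ord_max.
  rewrite /= jm /= in dj labelE nbd *.
  have pik i : p i = k -> i <= k.
    by move=> pi0; rewrite -ltnS -(subsimplex_pos i sk) /= pi0.
  have x_gt0 i : p i = k -> 0 < x i.
    move=> pi; rewrite lt0n; apply/negP => /eqP xi0.
    have [l lm lk] := labelE k (leqnn k).
    have : labels (x, p) l <= i.
      apply: label_le; apply: b0; rewrite ffunE /= xi0 pi.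
      by move: lm (ltn_ord l); rewrite -val_eqE /=; lia.
    rewrite lk => ki; have ik : i = k by apply: val_inj; apply/eqP; rewrite eqn_leq pik.
    have xk : x k = ord0 by apply: val_inj; rewrite /= -ik.
    have pk : p k = k by rewrite -{1}ik.
    by move: nbd; rewrite xk pk !eqxx.
  set x' := [ffun i => _]; set q := (p * _)%g.
  have xE i : p i = k -> x i = x' i + 1 :> nat.
    move=> pi; rewrite ffunE pi eqxx /=.
    have := x_gt0 i pi; have := ltn_ord (x i).
    case: (nat_of_ord (x i)) => //= a am _.
    by rewrite modnDr modn_small ?addn1 // ltnW.
  have vE l : l <= k -> labels (x', q) l.+1 = labels (x, p) l.
    move=> lk; rewrite /labels vertex_cyc //; last first.
      by move=> i pi; move: (ltn_ord (x i)); rewrite xE // addn1 ltnS.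
    congr (label (vertex (_, _) _)); apply/ffunP => i.
    by rewrite !ffunE; case: ifP => [/eqP ->|/eqP pi]; [rewrite eqxx; exact: ord_predK|case: eqP].
  have -> /= : subsimplex k.+1 (x', q).
    apply/subsimplexP => i ki /=; have [x0 pi] := sk' i ki.
    rewrite ffunE pi; have ik : i != k.
      by rewrite -val_eqE /=; apply: contraTneq ki => ->; rewrite ltnn.
    rewrite (negPf ik) x0; split=> //; apply: val_inj.
    rewrite permM pi /= cycE (negPf ik).
    by move: ki; case: ifP; lia.
  have -> /= : door (labels (x', q)) (ord0 : 'I_k.+2).
    apply: (doorW (g := fun l => inord l.+1)) dj => l.
    rewrite -!val_eqE /= => lm; have lk := ltn_ord l.
    rewrite inordK; last by move: lm lk; lia.
    by split=> //; rewrite vE //; move: lm lk; lia.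
  by [].
rewrite /= (negPf jm) /= !andbF /=.
have jk : j < k.+1 by rewrite ltn_neqAle -ltnS ltn_ord andbT; exact: jm.
have jn : j < n.+1 by apply: leq_trans jk (ltn_ord k).
have j_gt0 : 0 < j by rewrite lt0n; exact: j0.
set t := tperm _ _.
have tE (i : I) : t i = (if i == j.-1 :> nat then (j : nat) else
                         if i == j :> nat then j.-1 else i) :> nat.
  rewrite /t; case: tpermP => [->|->|/eqP h1 /eqP h2].
  - by rewrite !inordK ?eqxx //; move: jn; lia.
  - rewrite !inordK ?eqxx; try by move: jn j_gt0; lia.
    by rewrite ifN //; move: jn j_gt0; lia.
  - by move: h1 h2; rewrite -!val_eqE /= !inordK ?(leq_ltn_trans (leq_pred _)) // => /negPf-> /negPf->.
apply/andP; split.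
  apply/subsimplexP => i ki /=; have [x0 pi] := sk' i ki.
  split=> //; apply: val_inj; rewrite permM pi /= tE.
  by move: ki jk; repeat case: ifP; lia.
apply: (doorW (g := id)) dj => l lj; split=> //.
rewrite /labels; congr label; apply/ffunP => i; rewrite !ffunE /= permM tE.
by move: lj; rewrite -val_eqE /=; repeat case: ifP; lia.
Qed.

Definition full_simplices k : {set simplex} :=
  [set s | subsimplex k s && full k (labels s)].

Lemma odd_doors_full (k : I) : odd #|doors k| = odd #|full_simplices k.+1|.
Proof.
rewrite /doors /full_simplices -!sum1dep_card.
rewrite -(pair_big_dep (subsimplex k.+1) (fun s j => door (labels s) j) (fun _ _ => 1)) /=.
rewrite big_mkcondr /=.
apply: (big_ind2 (fun x y => odd x = odd y)) => // [x1 x2 y1 y2|s sk].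
  by rewrite !oddD => -> ->.
rewrite sum1dep_card odd_doors; first by case: ifP.
by move=> j jk; apply: labels_le.
Qed.

Lemma card_boundary_doors (k : I) : #|boundary_doors k| = #|full_simplices k|.
Proof.
rewrite -(card_imset (mem (full_simplices k)) (_ : injective (fun s => (s, ord_max : 'I_k.+2)))); last first.
  by move=> s t [].
congr #|pred_of_set _|; apply/setP => -[s j]; apply/idP/imsetP.
  rewrite !inE /= => /and4P[/andP[/subsimplexP sk dj] /eqP jm /eqP x0 /eqP pk].
  exists s; last by rewrite jm.
  rewrite inE; apply/andP; split.
    apply/subsimplexP => i; rewrite leq_eqVlt => /orP[/eqP ki|/sk//].
    by have -> : i = k by apply: val_inj.
  apply/forallP => c; move: dj => /forallP/(_ c)/existsP[l /andP[lj lc]].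
  have lk : l < k.+1.
    by move: lj; rewrite jm -val_eqE /=; move: (ltn_ord l); lia.
  by apply/existsP; exists (Ordinal lk).
case=> s'; rewrite inE => /andP[/subsimplexP sk fl] [-> ->].
rewrite !inE /= eqxx; have [-> ->] := sk k (leqnn k); rewrite !eqxx !andbT.
apply/andP; split; first by apply/subsimplexP => i ki; apply: sk; exact: ltnW.
apply/forallP => c; move: fl => /forallP/(_ c)/existsP[l lc].
apply/existsP; exists (widen_ord (leqnSn _) l); rewrite lc andbT -val_eqE /=.
by move: (ltn_ord l); lia.
Qed.

(** Modulo 2, the fully labelled simplices of dimension [k + 1] are as many as
    the doors ([odd_doors_full]); the inner doors cancel in pairs under
    [flip], and the boundary ones are the fully labelled simplices of dimension
    [k]. *)
Lemma odd_full_simplices k : k <= n.+1 -> odd #|full_simplices k|.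
Proof.
elim: k => [_|k IH kn].
  suff -> : full_simplices 0 = [set ([ffun=> ord0], 1%g)] by rewrite cards1.
  apply/setP => -[x p]; rewrite !inE; apply/andP/eqP.
    case=> /subsimplexP h _; congr (_, _); first by apply/ffunP => i; rewrite ffunE; case: (h i).
    by apply/permP => i; rewrite perm1; case: (h i).
  case=> -> ->; have s0 : subsimplex 0 ([ffun=> ord0], 1%g).
    by apply/subsimplexP => i _ /=; rewrite ffunE perm1.
  split=> //; apply/forallP => c; apply/existsP; exists ord0.
  by rewrite [c]ord1 -leqn0; exact: labels_le.
pose K : I := Ordinal kn; rewrite -[k.+1]/(K.+1) -odd_doors_full.
rewrite -(cardsID (boundary_doors K)) oddD.
have -> : doors K :&: boundary_doors K = boundary_doors K.
  by apply/setIidPr/subsetP => s; rewrite inE => /andP[].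
rewrite card_boundary_doors IH; last exact: ltnW.
rewrite (negPf (_ : ~~ odd #|doors K :\: boundary_doors K|)) //.
apply: (@involution_even _ _ (@flip K)) => [s|s|s] sE; first exact: flip_interior.
  exact: flipK.
exact: flip_neq.
Qed.

(** A fully labelled simplex exists by parity, and its vertices lie in one cell of
    the grid: the vertex with label [i] has bit [i] off, the one with label
    [n + 1] has all bits on. *)
Lemma kuhn : exists x : I -> nat,
  (forall i, x i <= m) /\ forall i (c : bool), exists v : {ffun I -> nat},
    (forall j, x j <= v j <= (x j).+1) /\ b v i = c.
Proof.
have : 0 < #|full_simplices n.+1| by rewrite odd_gt0 // odd_full_simplices.
case/card_gt0P => s; rewrite inE => /andP[_ /forallP fl].
exists (fun i => nat_of_ord (s.1 i)); split=> [i|i c]; first by rewrite -ltnS.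
have [j jc] : exists j, b (vertex s j) i = c.
  case: c.
    have /existsP[j /eqP jl] := fl ord_max; exists j.
    exact: label_max.
  have /existsP[j /eqP jl] := fl (widen_ord (leqnSn _) i); exists j.
  by apply/negbTE/label_eq.
exists (vertex s j); split=> // l; rewrite ffunE.
by case: (_ < _); rewrite ?addn0 ?addn1 leqnn leqnSn.
Qed.

End Kuhn.

(** * Brouwer's theorem on a cube *)

(** Ultrafilters replace the extraction of subsequences: one filter on [nat]
    serves all bounded sequences at once. *)
Lemma bounded_ultra_cvg (R : realType) (T : Type) (U : set_system T)
    (UU : UltraFilter U) (u : T -> R) (a b : R) :
  (forall n, a <= u n <= b) -> exists2 l, a <= l <= b & u x @[x --> U] --> l.
Proof.
move=> uab; have : (u x @[x --> U]) [set` `[a, b]].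
  by apply: (@filterE _ U) => x /=; rewrite in_itv /=; exact: uab.
move=> /(@segment_compact R a b)[l [/= lab ul]].
exists l => [|A lA]; first by rewrite in_itv in lab.
have [//|UnA] := in_ultra_setVsetC (u @^-1` A) UU.
by have [y [nAy Ay]] := ul (~` A) A UnA lA.
Qed.

Lemma natural_ultrafilter : exists2 U : set_system nat, UltraFilter U & \oo `<=` U.
Proof. by have [U [UU sU]] := ultraFilterLemma eventually_filter; exists U. Qed.

Section Brouwer.
Context {R : realType}.
Variables (n : nat) (r : R) (F : ('I_n.+1 -> R) -> 'I_n.+1 -> R).
Hypothesis r_gt0 : 0 < r.

Definition cube : set ('I_n.+1 -> R) := [set x | forall i, 0 <= x i <= r].

Hypothesis Fcube : forall x, cube x -> cube (F x).
Hypothesis Fcont : forall x, cube x -> forall e : R, 0 < e -> exists2 d : R, 0 < d &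
  forall y, cube y -> (forall i, `|y i - x i| <= d) ->
  forall i, `|F y i - F x i| <= e.

(** Kuhn's lemma for the bits [F x i <= x i] at the points of the grid of mesh
    [r / (m + 1)].  The boundary conditions on the bits are imposed by force on
    the faces of the cube, where they agree with [F] mapping the cube to
    itself. *)
Lemma brouwer_cell m : exists x : 'I_n.+1 -> R, cube x /\
  forall i (c : bool), exists y, [/\ cube y,
    forall j, `|y j - x j| <= r / m.+1%:R &
    if c then F y i <= y i else y i <= F y i].
Proof.
pose P (v : 'I_n.+1 -> nat) i : R := r * (v i)%:R / m.+1%:R.
have m_gt0 : 0 < m.+1%:R :> R by [].
have Pcube (v : 'I_n.+1 -> nat) : (forall j, (v j <= m.+1)%N) -> cube (P v).
  move=> vm i; rewrite /P divr_ge0 ?mulr_ge0 // ?(ltW r_gt0) //=.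
  by rewrite ler_pdivrMr // ler_pM2l // ler_nat.
pose b (v : {ffun 'I_n.+1 -> nat}) i :=
  (0 < v i)%N && ((v i == m.+1) || (F (P v) i <= P v i)).
have [||x [xm hx]] := @kuhn n m b.
- by move=> v i v0; rewrite /b v0.
- by move=> v i v0; rewrite /b v0 eqxx.
exists (P x); split; first by apply: Pcube => j; apply: leq_trans (xm j) _.
move=> i c; have [v [vx bv]] := hx i c.
have vm j : (v j <= m.+1)%N.
  by have /andP[_ /leq_trans ->] := vx j; rewrite ?ltnS.
exists (P v); split; first exact: Pcube.
  move=> j; rewrite /P -mulrBl -mulrBr normrM normrM (gtr0_norm r_gt0).
  rewrite (gtr0_norm (_ : 0 < m.+1%:R^-1)) ?invr_gt0 //.
  rewrite ler_pM2r ?invr_gt0 // ler_piMr ?(ltW r_gt0) //.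
  have /andP[xv vx1] := vx j.
  rewrite -natrB // normr_nat -[1]/(1%:R) ler_nat; lia.
have /(_ i)/andP[F0 Fr] := Fcube (Pcube _ vm).
move: bv; rewrite /b; case: c.
  case/andP => _ /orP[/eqP vi|//]; by rewrite {2}/P vi mulfK.
move/negbT; rewrite negb_and negb_or -leqNgt leqn0 -ltNge.
by case/orP => [/eqP vi|/andP[_ /ltW//]]; rewrite {1}/P vi mulr0 mul0r.
Qed.

(** Arbitrarily close to a limit of ever smaller cells, [F y i - y i] takes both
    signs for every [i], so it vanishes at the limit by continuity. *)
Lemma brouwer_cube : exists2 x, cube x & forall i, F x i = x i.
Proof.
have [z hz] := choice brouwer_cell.
have [U UU sU] := natural_ultrafilter.
have /choice[x hx] : forall i, exists l, 0 <= l <= r /\ z m i @[m --> U] --> l.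
  move=> i; have [|l lr zl] := bounded_ultra_cvg UU (u := z ^~ i) (a := 0) (b := r).
    by move=> m; have [zc _] := hz m; exact: zc.
  by exists l.
have xcube : cube x by move=> i; case: (hx i).
exists x => // i.
have key (c : bool) e : 0 < e -> exists2 y, cube y /\ (forall j, `|y j - x j| <= e) &
    if c then F y i <= y i else y i <= F y i.
  move=> e0; have e20 : 0 < e / 2 by rewrite divr_gt0.
  have : \forall m \near U, (forall j, `|x j - z m j| <= e / 2) /\ r / m.+1%:R <= e / 2.
    apply: filterI.
      apply: filter_forall => j; have [_] := hx j.
      by move/cvgrPdist_le; apply.
    apply: sU; exists (Num.truncn (2 * r / e)) => // m /= hm.
    have : 2 * r / e < m.+1%:R.
      apply: lt_le_trans (truncnS_gt _) _; by rewrite ler_nat.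
    rewrite ltr_pdivrMr // => h; rewrite ler_pdivrMr // mulrAC ler_pdivlMr //.
    by rewrite mulrC (le_trans (ltW h)) // mulrC.
  case/filter_ex => m [xz rm]; have [_ /(_ i c)[y [yc yz hy]]] := hz m.
  exists y => //; split=> // j; rewrite -(subrK (z m j) (y j)) -addrA.
  rewrite (le_trans (ler_normD _ _)) // [leRHS](splitr e) lerD //.
    exact: le_trans (yz j) rm.
  by rewrite distrC.
have [lt|gt|//] := ltgtP (F x i) (x i).
  have e0 : 0 < (x i - F x i) / 3 by lra.
  have [d d0 hd] := Fcont xcube e0.
  have [|y [yc yx] yF] := key false (Num.min d ((x i - F x i) / 3)).
    by rewrite lt_min d0.
  have h1 : `|F y i - F x i| <= (x i - F x i) / 3.
    by apply: hd => // j; have := yx j; rewrite le_min => /andP[].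
  have : `|y i - x i| <= (x i - F x i) / 3.
    by have := yx i; rewrite le_min => /andP[].
  by move: h1; rewrite !ler_norml => /andP[? ?] /andP[? ?]; lra.
have e0 : 0 < (F x i - x i) / 3 by lra.
have [d d0 hd] := Fcont xcube e0.
have [|y [yc yx] yF] := key true (Num.min d ((F x i - x i) / 3)).
  by rewrite lt_min d0.
have h1 : `|F y i - F x i| <= (F x i - x i) / 3.
  by apply: hd => // j; have := yx j; rewrite le_min => /andP[].
have : `|y i - x i| <= (F x i - x i) / 3.
  by have := yx i; rewrite le_min => /andP[].
by move: h1; rewrite !ler_norml => /andP[? ?] /andP[? ?]; lra.
Qed.

End Brouwer.

(** * Schauder's theorem for Lipschitz images *)

Section Clamp.
Context {R : realType}.
Implicit Types (s t a b : R) (w : R -> R).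

Definition clamp a b t : R := Num.max a (Num.min b t).

Lemma clamp_itv a b t : a <= b -> a <= clamp a b t <= b.
Proof. by move=> ab; rewrite /clamp le_max lexx /= ge_max ab ge_min lexx. Qed.

Lemma clamp_id a b t : a <= t <= b -> clamp a b t = t.
Proof. by case/andP=> ta tb; rewrite /clamp (min_idPr tb) (max_idPr ta). Qed.

Lemma le_clamp a b s t : s <= t -> clamp a b s <= clamp a b t.
Proof.
move=> st; rewrite /clamp ge_max !le_max lexx /= le_min !ge_min lexx /= st.
by rewrite !orbT.
Qed.

Lemma clamp_lip a b s t : a <= b -> `|clamp a b s - clamp a b t| <= `|s - t|.
Proof.
move=> ab; wlog st : s t / s <= t => [h|].
  have [/h //|/ltW/h] := leP s t.
  by rewrite distrC [`|s - t|]distrC.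
rewrite (ler0_norm (_ : s - t <= 0)) ?subr_le0 //.
rewrite ler0_norm ?subr_le0 ?le_clamp //.
rewrite /clamp; case: (leP b s) (leP b t) => [bs|sb] [bt|tb];
  rewrite ?(max_idPr ab); try lra.
- by case: (leP a s) => ?; lra.
- by case: (leP a s) (leP a t) => ? [] ?; lra.
Qed.

Lemma near_dist_le t (e : R) : 0 < e -> \forall s \near t, `|t - s| <= e.
Proof. by move=> e0; have /cvgrPdist_le := @cvg_id _ (nbhs t); exact. Qed.

Lemma lip_continuous (L : R) w :
  (forall s t, `|w s - w t| <= L * `|s - t|) -> continuous w.
Proof.
move=> wL t; apply/cvgrPdist_le => e e0.
have L0 : 0 <= `|L| by [].
have d0 : 0 < e / (`|L| + 1) by rewrite divr_gt0 // ltr_pwDr.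
near=> s; apply: (le_trans (wL t s)).
have : `|t - s| <= e / (`|L| + 1).
  by near: s; exact: near_dist_le.
rewrite ler_pdivlMr ?ltr_pwDr // => h.
apply: le_trans h; rewrite mulrC ler_wpM2l //.
by rewrite (le_trans (ler_norm _)) // lerDl.
Unshelve. all: by end_near. Qed.

Lemma clamp_continuous a b : a <= b -> continuous (clamp a b).
Proof.
by move=> ab; apply: (@lip_continuous 1) => s t; rewrite mul1r clamp_lip.
Qed.

End Clamp.
Notation clamp01 := (clamp 0 1).

Section Interpolation.
Context {R : realType}.
Variable n : nat.
Implicit Types (t : R) (x y : 'I_n.+2 -> R).

(** The piecewise linear bump at the node [i / (n + 1)], written as a difference
    of two clamped ramps so that the sum over the nodes telescopes to 1. *)
Definition hat (i : nat) t : R :=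
  clamp01 (n.+1%:R * t + 1 - i%:R) - clamp01 (n.+1%:R * t - i%:R).

Lemma hat_ge0 i t : 0 <= hat i t.
Proof. by rewrite subr_ge0 le_clamp // lerD2r lerDl. Qed.

Lemma hat_sum t : 0 <= t <= 1 -> \sum_(i < n.+2) hat i t = 1.
Proof.
case/andP=> t0 t1.
rewrite -(big_mkord xpredT (fun i => hat i t)) /hat.
pose g (i : nat) := - clamp01 (n.+1%:R * t + 1 - i%:R).
rewrite (eq_bigr (fun i => g i.+1 - g i)); last first.
  move=> i _; rewrite /g opprK addrC; congr (- clamp01 _ + _).
  by rewrite -natr1; ring.
rewrite telescope_sumr // /g opprK subr0.
have -> : n.+1%:R * t + 1 - n.+2%:R = n.+1%:R * t - n.+1%:R.
  by rewrite -[n.+2%:R]natr1; ring.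
have -> : clamp01 (n.+1%:R * t - n.+1%:R) = 0 :> R.
  apply/max_idPl; rewrite ge_min; apply/orP; right.
  by rewrite subr_le0 ler_piMr.
rewrite oppr0 add0r; apply/eqP; rewrite eq_le; have /andP[_ ->] := @clamp_itv R 0 1 (n.+1%:R * t + 1) ler01.
rewrite /clamp /= le_max le_min lexx lerDr mulr_ge0 ?orbT //.
Qed.

Lemma hat_eq0 i t : 1 <= `|n.+1%:R * t - i%:R| -> hat i t = 0.
Proof.
rewrite ler_normr /hat => /orP[h|h].
  rewrite /clamp !(min_idPl _) ?subrr //.
  by rewrite addrAC lerDr (le_trans ler01).
rewrite /clamp !(max_idPl _) ?subrr // ge_min; apply/orP; right; lra.
Qed.

Definition interp x t : R := \sum_(i < n.+2) x i * hat i (clamp01 t).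

(** [interp x t] is an average of the nodal values, with weights supported at the
    nodes next to [t]. *)
Lemma interp_near x t (c e : R) : 0 <= e ->
  (forall i : 'I_n.+2, hat i (clamp01 t) != 0 -> `|x i - c| <= e) ->
  `|interp x t - c| <= e.
Proof.
move=> e0 xc; have h1 := hat_sum (@clamp_itv R 0 1 t ler01).
have avg a : a = \sum_(i < n.+2) a * hat i (clamp01 t) by rewrite -mulr_sumr h1 mulr1.
rewrite /interp {1}[c]avg -sumrB [e]avg.
apply: le_trans (ler_norm_sum _ _ _) _; apply: ler_sum => i _.
rewrite -mulrBl normrM (ger0_norm (hat_ge0 _ _)).
have [->|/xc h] := eqVneq (hat i (clamp01 t)) 0; first by rewrite !mulr0.
by rewrite ler_wpM2r // hat_ge0.
Qed.

Lemma interp_itv x (r : R) t : (forall i, 0 <= x i <= r) -> 0 <= interp x t <= r.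
Proof.
move=> xr; have r2 : 0 <= r / 2.
  by have /andP[h1 h2] := xr ord0; rewrite divr_ge0 // (le_trans h1 h2).
have : `|interp x t - r / 2| <= r / 2.
  apply: interp_near => // i _; have /andP[h1 h2] := xr i.
  by rewrite ler_norml; apply/andP; split; lra.
by rewrite ler_norml => /andP[? ?]; apply/andP; split; lra.
Qed.

Lemma interp_lip x y (e : R) t :
  (forall i, `|x i - y i| <= e) -> `|interp x t - interp y t| <= e.
Proof.
move=> xy; have -> : interp x t - interp y t = interp (fun i => x i - y i) t - 0.
  by rewrite subr0 /interp -sumrB; apply: eq_bigr => i _; rewrite mulrBl.
apply: interp_near => [|i _]; first by rewrite (le_trans _ (xy ord0)).
by rewrite subr0.
Qed.

Lemma interp_approx (L : R) (g : R -> R) t : 0 <= L ->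
  (forall s t, 0 <= s <= 1 -> 0 <= t <= 1 -> `|g s - g t| <= L * `|s - t|) ->
  0 <= t <= 1 -> `|interp (fun i => g (i%:R / n.+1%:R)) t - g t| <= L / n.+1%:R.
Proof.
move=> L0 gL t01; apply: interp_near => [|i]; first by rewrite divr_ge0.
rewrite clamp_id // => hi; have h : `|n.+1%:R * t - i%:R| <= 1.
  by rewrite ltW // ltNge; apply: contra hi => /hat_eq0 ->.
apply: le_trans (gL _ _ _ t01) _.
  rewrite divr_ge0 //= ler_pdivrMr // mul1r ler_nat -ltnS; exact: ltn_ord.
rewrite ler_wpM2l // -(@ler_pM2l _ n.+1%:R) // mulfV ?gt_eqF //.
rewrite -[X in X * _](@gtr0_norm _ n.+1%:R) // -normrM mulrBr mulrC mulfVK ?gt_eqF //.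
by rewrite distrC.
Qed.

Lemma interp_continuous x : continuous (interp x).
Proof.
have cl : continuous (clamp01 : R -> R) by exact: clamp_continuous.
have cvt (c : R) : continuous (fun s => n.+1%:R * clamp01 s - c).
  by move=> s; apply: cvgB; [apply: cvgM; [exact: cvg_cst|exact: cl]|exact: cvg_cst].
have cc (c : R) : continuous (fun s => clamp01 (n.+1%:R * clamp01 s - c) : R).
  by move=> s; exact: (continuous_comp (cvt c s) (cl _)).
move=> t; rewrite /interp; apply: cvg_big => [|i _]; first exact: add_continuous.
apply: cvgM; first exact: cvg_cst.
have -> : (fun s => hat i (clamp01 s)) = (fun s =>
    clamp01 (n.+1%:R * clamp01 s - (i%:R - 1)) - clamp01 (n.+1%:R * clamp01 s - i%:R)).
  by apply/funext => s; rewrite /hat opprB addrA addrAC.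
rewrite /hat -addrA -[1 - _]opprB.
by apply: cvgB; exact: cc.
Qed.

End Interpolation.

Section Schauder.
Context {R : realType}.
Variables (r L : R) (T : (R -> R) -> R -> R).
Hypotheses (r_gt0 : 0 < r) (L_ge0 : 0 <= L).
Implicit Types (s t e d : R) (v w : R -> R).

(** Functions on the whole line are used, so that continuity is the ordinary one;
    only their restriction to [0, 1] matters. *)
Definition band : set (R -> R) := [set w : R -> R | continuous w /\ forall t, 0 <= w t <= r].

Hypothesis T_itv : forall w, band w -> forall t, 0 <= t <= 1 -> 0 <= T w t <= r.
Hypothesis T_lip : forall w, band w -> forall s t, 0 <= s <= 1 -> 0 <= t <= 1 ->
  `|T w s - T w t| <= L * `|s - t|.
Hypothesis T_cont : forall w, band w -> forall e, 0 < e -> exists2 d : R, 0 < d &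
  forall v, band v -> (forall t, 0 <= t <= 1 -> `|v t - w t| <= d) ->
  forall t, 0 <= t <= 1 -> `|T v t - T w t| <= e.

(** Brouwer's theorem for the values at the nodes of the image of the
    interpolation: at a fixed point, [w] interpolates the Lipschitz function
    [T w]. *)
Lemma schauder_approx n : exists w, band w /\
  forall t, 0 <= t <= 1 -> `|w t - T w t| <= L / n.+1%:R.
Proof.
have node01 (i : 'I_n.+2) : 0 <= (i%:R / n.+1%:R : R) <= 1.
  by rewrite divr_ge0 //= ler_pdivrMr // mul1r ler_nat -ltnS; exact: ltn_ord.
have interp_band (x : 'I_n.+2 -> R) : cube r x -> band (interp x).
  by move=> xr; split=> [|t]; [exact: interp_continuous|exact: interp_itv].
pose F (x : 'I_n.+2 -> R) (i : 'I_n.+2) := T (interp x) (i%:R / n.+1%:R).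
have [||x xr Fx] := @brouwer_cube R n.+1 r F r_gt0.
- by move=> x xr i; apply: T_itv => //; exact: interp_band.
- move=> x xr e e0; have [d d0 hd] := T_cont (interp_band x xr) e0.
  exists d => // y yr xy i; apply: hd => //; first exact: interp_band.
  by move=> t _; apply: interp_lip.
exists (interp x); split=> [|t t01]; first exact: interp_band.
have := interp_approx n L_ge0 (T_lip (interp_band x xr)) t01.
by rewrite (_ : (fun i => _) = x) //; apply/funext => i; rewrite -[RHS]Fx.
Qed.

(** The images of the approximate fixed points are equi-Lipschitz, so their
    pointwise limit along an ultrafilter is uniform on [0, 1] by compactness, and
    the approximate fixed points converge to the same limit. *)
Lemma schauder_fixed_point : exists2 w, band w & forall t, 0 <= t <= 1 -> T w t = w t.
Proof.
have [z hz] := choice schauder_approx.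
have [U UU sU] := natural_ultrafilter.
have c01 t : 0 <= (clamp01 t : R) <= 1 by exact: clamp_itv.
have /choice[w hw] : forall t, exists l,
    0 <= l <= r /\ T (z n) (clamp01 t) @[n --> U] --> l.
  move=> t; have [|l lr zl] := bounded_ultra_cvg UU
     (u := fun n => T (z n) (clamp01 t)) (a := 0) (b := r).
    by move=> m; have [zc _] := hz m; exact: T_itv.
  by exists l.
have wnear t e : 0 < e -> \forall n \near U, `|w t - T (z n) (clamp01 t)| <= e.
  by move=> e0; have [_ /cvgrPdist_le] := hw t; exact.
have wL s t : `|w s - w t| <= L * `|s - t|.
  apply/ler_addgt0Pr => e e0; have e20 : 0 < e / 2 by lra.
  have [n [h1 h2]] := filter_ex (@filterI _ U _ _ _ (wnear s _ e20) (wnear t _ e20)).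
  have [zn _] := hz n; have h3 := T_lip zn (c01 s) (c01 t).
  have h4 : L * `|clamp01 s - clamp01 t| <= L * `|s - t|.
    by rewrite ler_wpM2l // clamp_lip.
  move: h1 h2 (le_trans h3 h4); rewrite !ler_norml.
  by move=> /andP[? ?] /andP[? ?] /andP[? ?]; apply/andP; split; lra.
have wb : band w.
  by split; [exact: lip_continuous wL|move=> t; case: (hw t)].
have unif e : 0 < e -> \forall n \near U, forall t, 0 <= t <= 1 -> `|T (z n) t - w t| <= e.
  move=> e0; have e30 : 0 < e / 3 by lra.
  have : near_covering [set` `[0, 1 : R]].
    by apply/compact_near_coveringP; exact: segment_compact.
  move/near_covering_withinP => /(_ nat U (fun n t => `|T (z n) t - w t| <= e)) H.
  have /H : forall x : R, [set` `[0, 1]] x -> \forall x' \near x & n \near U,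
      [set` `[0, 1]] x' -> `|T (z n) x' - w x'| <= e.
    move=> x; rewrite /= in_itv /= => x01.
    have Lx : \forall x' \near x, L * `|x' - x| <= e / 3.
      near=> x'; have : `|x - x'| <= e / 3 / (L + 1).
        near: x'; apply: near_dist_le.
        by rewrite divr_gt0 // ltr_pwDr.
      rewrite ler_pdivlMr ?ltr_pwDr // => h; apply: le_trans h.
      by rewrite mulrC distrC ler_wpM2l // lerDl.
    exists ([set x' | L * `|x' - x| <= e / 3], [set n | `|w x - T (z n) (clamp01 x)| <= e / 3]).
      by split=> //; exact: wnear.
    move=> [x' n] /= [h1 h2]; rewrite in_itv /= => x'01.
    have [zn _] := hz n; have h3 := T_lip zn x'01 x01.
    rewrite clamp_id // in h2; have h4 := wL x' x.
    move: h2 (le_trans h3 h1) (le_trans h4 h1); rewrite !ler_norml.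
    by move=> /andP[? ?] /andP[? ?] /andP[? ?]; apply/andP; split; lra.
  by apply: filterS => n h t t01; apply: h; rewrite /= in_itv.
exists w => // t t01; apply/eqP; rewrite -subr_eq0 -normr_le0.
apply/ler_addgt0Pr => e e0; rewrite add0r.
have e20 : 0 < e / 2 by lra.
have [d d0 hd] := T_cont wb e20.
have d20 : 0 < d / 2 by lra.
have Ln : \forall n \near U, L / n.+1%:R <= d / 2.
  apply: sU; exists (Num.truncn (2 * L / d)) => // m /= hm.
  have : 2 * L / d < m.+1%:R.
    by apply: lt_le_trans (truncnS_gt _) _; rewrite ler_nat.
  rewrite ltr_pdivrMr // => h; rewrite ler_pdivrMr // mulrAC ler_pdivlMr //.
  by rewrite mulrC (le_trans (ltW h)) // mulrC.
have [n [[h1 h2] h3]] := filter_ex (@filterI _ U _ _ _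
  (@filterI _ U _ _ _ (unif _ d20) (unif _ e20)) Ln).
have [zn zS] := hz n.
have h4 : forall t, 0 <= t <= 1 -> `|z n t - w t| <= d.
  move=> s s01; move: (h1 s s01) (le_trans (zS s s01) h3); rewrite !ler_norml.
  by move=> /andP[? ?] /andP[? ?]; apply/andP; split; lra.
move: (hd _ zn h4 t t01) (h2 t t01); rewrite !ler_norml.
by move=> /andP[? ?] /andP[? ?]; apply/andP; split; lra.
Unshelve. all: by end_near. Qed.

End Schauder.

(** * One-sided derivatives, the C3 norm and primitives on [0, 1] *)

Section DerivativesOn01.
Context {R : realType}.
Implicit Types (s t e : R) (u v w : R -> R).

(** The relation [v = u'] on [0, 1] in the one-sided sense.  Unlike an
    equation for [derive01], it carries the existence of the limits, so that it
    passes to differences. *)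
Definition derivative01 u v := forall t, 0 <= t <= 1 ->
  quotient01 u t x @[x --> within `[0, 1] t^'] --> v t.

Lemma proper_within01 t : 0 <= t <= 1 -> ProperFilter (within `[0, 1] t^').
Proof.
move=> /andP[t0 t1]; apply: Build_ProperFilter_ex => A.
rewrite /within /= => /nbhs_ballP[e /= e0 eA].
have {}e0 : 0 < e by [].
pose d := Num.min (e / 2) (1 / 2).
have [d0 de d1] : [/\ 0 < d, d < e & d <= 1 / 2].
  by rewrite /d; case: (leP (e / 2) (1 / 2)) => h; split; lra.
have [t2|t2] := leP t (1 / 2).
  exists (t + d); apply: eA; rewrite /ball /= ?in_itv /=.
  - by rewrite opprD addrA subrr add0r normrN gtr0_norm.
  - by apply/eqP; lra.
  - by apply/andP; split; lra.
exists (t - d); apply: eA; rewrite /ball /= ?in_itv /=.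
- by rewrite opprB addrC subrK gtr0_norm.
- by apply/eqP; lra.
- by apply/andP; split; lra.
Qed.

Lemma derivative01_derive u v t : derivative01 u v -> 0 <= t <= 1 ->
  derivable01 u t /\ derive01 u t = v t.
Proof.
move=> uv t01; have tP := proper_within01 t01; have ut := uv t t01.
by split; [apply/cvg_ex; exists (v t)|apply: cvg_lim].
Qed.

Lemma eq_derivative01 u u' v v' :
  (forall t, 0 <= t <= 1 -> u t = u' t) -> (forall t, 0 <= t <= 1 -> v t = v' t) ->
  derivative01 u v -> derivative01 u' v'.
Proof.
move=> uu vv uv t t01; rewrite -vv //; move: (uv t t01); apply: cvg_trans.
apply: near_eq_cvg; rewrite near_withinE; near=> s; rewrite /= in_itv /= => s01.
by rewrite /quotient01 !uu.
Unshelve. all: by end_near. Qed.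

Lemma derivative01B u v u' v' : derivative01 u v -> derivative01 u' v' ->
  derivative01 (u \- u') (v \- v').
Proof.
move=> uv uv' t t01.
rewrite (_ : quotient01 _ t = fun s => quotient01 u t s - quotient01 u' t s).
  by apply: cvgB; [exact: uv|exact: uv'].
by apply/funext => s; rewrite /quotient01 /= -mulrBl; congr (_ / _); ring.
Qed.

Lemma is_derive_derivative01 u v :
  (forall t, 0 <= t <= 1 -> is_derive t 1 u (v t)) -> derivative01 u v.
Proof.
move=> uv t t01; have [du du1] := uv t t01.
have : h^-1 *: ((u \o shift t) (h *: 1) - u t) @[h --> 0^'] --> v t.
  by rewrite -du1; apply: du.
move=> /cvgrPdist_le H; apply/cvgrPdist_le => e e0.
have /nbhs_ballP[d /= d0 hd] := H e e0.
apply/nbhs_ballP; exists d => //= s ts st _.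
have := hd (s - t); rewrite /ball /= sub0r opprB => /(_ ts).
rewrite /quotient01 /shift /= subr_eq0 => /(_ st).
by rewrite /GRing.scale /= mulr1 subrK mulrC.
Qed.

Lemma derivative01_jet u0 u1 u2 u3 :
  derivative01 u0 u1 -> derivative01 u1 u2 -> derivative01 u2 u3 ->
  forall t, 0 <= t <= 1 -> [/\ derive01n 1 u0 t = u1 t, derive01n 2 u0 t = u2 t,
    derive01n 3 u0 t = u3 t &
    forall j, (j < 3)%N -> derivable01 (derive01n j u0) t].
Proof.
move=> d0 d1 d2.
have e1 t : 0 <= t <= 1 -> derive01n 1 u0 t = u1 t.
  by move=> t01; have [] := derivative01_derive d0 t01.
have d1' : derivative01 (derive01n 1 u0) u2.
  by apply: eq_derivative01 d1 => // t t01; rewrite e1.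
have e2 t : 0 <= t <= 1 -> derive01n 2 u0 t = u2 t.
  by move=> t01; have [] := derivative01_derive d1' t01.
have d2' : derivative01 (derive01n 2 u0) u3.
  by apply: eq_derivative01 d2 => // t t01; rewrite e2.
have e3 t : 0 <= t <= 1 -> derive01n 3 u0 t = u3 t.
  by move=> t01; have [] := derivative01_derive d2' t01.
move=> t t01; split; rewrite ?e1 ?e2 ?e3 //.
case=> [|[|[|//]]] _.
- by have [] := derivative01_derive d0 t01.
- by have [] := derivative01_derive d1' t01.
- by have [] := derivative01_derive d2' t01.
Qed.

Lemma norm_infty_le w e :
  (forall t, 0 <= t <= 1 -> `|w t| <= e) -> norm_infty w <= e.
Proof.
move=> we; apply: ge_sup.
  by exists `|w 0|; exists 0 => //=; rewrite in_itv /= lexx ler01.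
by move=> _ [t /= + <-]; rewrite in_itv /= => /we.
Qed.

Lemma norm_infty_ge w e t :
  (forall t, 0 <= t <= 1 -> `|w t| <= e) -> 0 <= t <= 1 -> `|w t| <= norm_infty w.
Proof.
move=> we t01; apply: ub_le_sup; last by exists t; rewrite //= in_itv.
by exists e => _ [s /= + <-]; rewrite in_itv /= => /we.
Qed.

Lemma norm3_le u e : 0 <= e ->
  (forall j t, (j < 4)%N -> 0 <= t <= 1 -> `|derive01n j u t| <= e) -> norm3 u <= e.
Proof.
move=> e0 ue; rewrite /norm3; apply: bigmax_le => // j _.
by apply: norm_infty_le => t; exact: ue.
Qed.

Lemma norm3_ge u e t :
  (forall t, 0 <= t <= 1 -> `|derive01n 3 u t| <= e) -> 0 <= t <= 1 ->
  `|derive01n 3 u t| <= norm3 u.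
Proof.
move=> ue t01; apply: le_trans (norm_infty_ge ue t01) _.
by rewrite /norm3; exact: (le_bigmax _ (fun j : 'I_4 => norm_infty (derive01n j u)) ord_max).
Qed.

End DerivativesOn01.

Section Primitives.
Context {R : realType}.
Implicit Types (s t e : R) (g h F : R -> R).
Notation mu := (@lebesgue_measure R).

(** The integral starts at [-1] rather than at 0 so that 0 is interior and the
    primitive has an ordinary, two-sided derivative at both ends of [0, 1]. *)
Definition primitive g t : R :=
  \int[mu]_(s in `[-1, t]) g s - \int[mu]_(s in `[-1, 0]) g s.

Lemma primitive0 g : primitive g 0 = 0.
Proof. by rewrite /primitive subrr. Qed.

Lemma continuous_integrable01 g a b : {within `[a, b], continuous g} ->
  mu.-integrable `[a, b] (EFin \o g).
Proof. by move=> cg; apply: continuous_compact_integrable => //; exact: segment_compact. Qed.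

Lemma is_derive_primitive g t : continuous g -> 0 <= t <= 1 ->
  is_derive t 1 (primitive g) (g t).
Proof.
move=> cg /andP[t0 t1].
have int2 : mu.-integrable `[-1, 2] (EFin \o g).
  by apply: continuous_integrable01; exact: continuous_subspaceT.
have [| |dG G1] := @continuous_FTC1 R g (BLeft (-1)) t 2 _ int2 _ (cg t).
- by lra.
- by rewrite /= lte_fin; lra.
set G := (fun x => _) in dG G1.
have dG' : is_derive t 1 G (g t) by apply: (DeriveDef dG); rewrite -derive1E; exact: G1.
have -> : primitive g = G - cst (\int[mu]_(s in `[-1, 0]) g s) by [].
by apply: is_derive_eq; rewrite subr0.
Qed.

Lemma mvt01 F g s t : (forall x : R, 0 <= x <= 1 -> is_derive x 1 F (g x)) ->
  0 <= s -> s <= t -> t <= 1 ->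
  exists2 c, 0 <= c <= 1 & F t - F s = g c * (t - s).
Proof.
move=> Fg s0 st t1.
have Fg' x : s <= x <= t -> is_derive x 1 F (g x).
  by move=> /andP[sx xt]; apply: Fg; rewrite (le_trans s0 sx) (le_trans xt t1).
have oo x : x \in `]s, t[ -> is_derive x 1 F (g x).
  by rewrite in_itv /= => /andP[sx xt]; apply: Fg'; rewrite !ltW.
have cF : {within `[s, t], continuous F}.
  apply: derivable_within_continuous => y; rewrite in_itv /= => yst.
  by have [] := Fg' y yst.
have [c cst E] := MVT_segment st oo cF.
exists c => //; move: cst; rewrite in_itv /= => /andP[sc ct].
by rewrite (le_trans s0 sc) (le_trans ct t1).
Qed.

Lemma FTC01 F g s t : (forall x : R, 0 <= x <= 1 -> is_derive x 1 F (g x)) ->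
  continuous g -> 0 <= s -> s <= t -> t <= 1 ->
  \int[mu]_(x in `[s, t]) g x = F t - F s.
Proof.
move=> Fg cg s0 st t1; move: st; rewrite le_eqVlt => /orP[/eqP <-|st].
  by rewrite set_itv1 Rintegral_set1 subrr.
have cF x : 0 <= x <= 1 -> {for x, continuous F}.
  by move=> /Fg [dF _]; apply: differentiable_continuous; exact/derivable1_diffP.
rewrite /Rintegral (@continuous_FTC2 _ _ F) //.
- exact: continuous_subspaceT.
- split=> [x|  |].
  + by rewrite in_itv /= => /andP[sx xt]; have [|] := Fg x; rewrite ?(le_trans s0 (ltW sx)) ?(le_trans (ltW xt) t1).
  + by apply: cvg_at_right_filter; apply: cF; lra.
  + by apply: cvg_at_left_filter; apply: cF; lra.
- move=> x; rewrite in_itv /= => /andP[sx xt].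
  by have [|dF F1] := Fg x; [apply/andP; split; lra|rewrite derive1E].
Qed.

(** Clamping the argument gives a function that is continuous on the line, so
    that the construction can be iterated. *)
Definition prim01 g t : R := primitive g (clamp01 t).

Lemma prim01E g t : 0 <= t <= 1 -> prim01 g t = primitive g t.
Proof. by move=> t01; rewrite /prim01 clamp_id. Qed.

Lemma prim01_0 g : prim01 g 0 = 0.
Proof. by rewrite prim01E ?primitive0 // lexx ler01. Qed.

Lemma prim01_continuous g : continuous g -> continuous (prim01 g).
Proof.
move=> cg t; have c01 := @clamp_itv R 0 1 t ler01.
apply: (continuous_comp (f := clamp01 : R -> R) (g := primitive g)).
  exact: clamp_continuous.
have [dF _] := is_derive_primitive cg c01.
by apply: differentiable_continuous; exact/derivable1_diffP.
Qed.

Lemma prim01_derivative01 g : continuous g -> derivative01 (prim01 g) g.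
Proof.
move=> cg; apply: (@eq_derivative01 _ (primitive g) _ g) => //.
  by move=> t t01; rewrite prim01E.
by apply: is_derive_derivative01 => t; exact: is_derive_primitive.
Qed.

Lemma prim01_mvt g s t : continuous g -> s <= t ->
  exists2 c, 0 <= c <= 1 & prim01 g t - prim01 g s = g c * (clamp01 t - clamp01 s).
Proof.
move=> cg st; have /andP[s0 _] := @clamp_itv R 0 1 s ler01.
have /andP[_ t1] := @clamp_itv R 0 1 t ler01.
apply: (@mvt01 (primitive g) g) => //; last exact: le_clamp.
by move=> x; exact: is_derive_primitive.
Qed.

Lemma prim01_le g s t : continuous g -> (forall x : R, 0 <= x <= 1 -> 0 <= g x) ->
  s <= t -> prim01 g s <= prim01 g t.
Proof.
move=> cg g0 st; have [c c01 E] := prim01_mvt cg st.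
by rewrite -subr_ge0 E mulr_ge0 ?g0 // subr_ge0 le_clamp.
Qed.

Lemma prim01_itv g (r : R) t : continuous g ->
  (forall x : R, 0 <= x <= 1 -> 0 <= g x <= r) -> 0 <= prim01 g t <= r.
Proof.
move=> cg gr; have c01 := @clamp_itv R 0 1 t ler01.
have /andP[t0 t1] := c01.
have [c c01' E] := prim01_mvt cg t0.
have {}E : prim01 g t = g c * clamp01 t.
  move: E; rewrite prim01_0 subr0 !(@clamp_id _ _ _ _ c01) /prim01 clamp_id //.
  by rewrite (@clamp_id _ 0 1 0) ?lexx ?ler01 // subr0.
have /andP[g0 gr'] := gr c c01'.
rewrite E mulr_ge0 //=; apply: le_trans gr'.
by rewrite ler_piMr.
Qed.

Lemma prim01_dist g h e t : continuous g -> continuous h ->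
  (forall x : R, 0 <= x <= 1 -> `|g x - h x| <= e) -> `|prim01 g t - prim01 h t| <= e.
Proof.
move=> cg ch ghe; have c01 := @clamp_itv R 0 1 t ler01.
have /andP[t0 t1] := c01.
have D (x : R) : 0 <= x <= 1 ->
    is_derive x 1 (primitive g - primitive h) (g x - h x).
  move=> x01; have := is_derive_primitive cg x01; have := is_derive_primitive ch x01.
  by move=> ? ?; exact: is_deriveB.
have [c c01' E] := mvt01 (g := g - h) D (lexx 0) t0 t1.
move: E; rewrite !fctE !primitive0 !subr0 /prim01 => ->.
rewrite normrM (ger0_norm t0); apply: le_trans (ghe c c01').
by rewrite ler_piMr.
Qed.

Lemma prim01_lip g (M : R) s t : continuous g ->
  (forall x : R, 0 <= x <= 1 -> `|g x| <= M) -> `|prim01 g s - prim01 g t| <= M * `|s - t|.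
Proof.
move=> cg gM; wlog st : s t / s <= t => [h|].
  have [/h //|/ltW/h] := leP s t.
  by rewrite distrC [`|s - t|]distrC.
have [c c01 E] := prim01_mvt cg st.
rewrite distrC E normrM (le_trans (ler_wpM2r _ (gM c c01))) //.
rewrite ler_wpM2l ?(le_trans _ (gM c c01)) // [`|s - t|]distrC.
exact: clamp_lip.
Qed.

End Primitives.

(** * Functions with prescribed third derivative *)

Section Jets.
Context {R : realType}.
Implicit Types (r s t e : R) (v w : R -> R).

(** With [u = lift0 w], [lift1 w] and [lift2 w] are [u'] and [u''], and
    [u''' = - w]; the boundary conditions are [u(0) = u'(0) = u''(1) = 0]. *)
Definition lift2 w t : R := prim01 w 1 - prim01 w t.
Definition lift1 w : R -> R := prim01 (lift2 w).
Definition lift0 w : R -> R := prim01 (lift1 w).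

Lemma lift2_continuous w : continuous w -> continuous (lift2 w).
Proof. by move=> cw t; apply: cvgB; [exact: cvg_cst|exact: prim01_continuous]. Qed.

Lemma lift1_continuous w : continuous w -> continuous (lift1 w).
Proof. by move=> cw; apply: prim01_continuous; exact: lift2_continuous. Qed.

Lemma lift0_continuous w : continuous w -> continuous (lift0 w).
Proof. by move=> cw; apply: prim01_continuous; exact: lift1_continuous. Qed.

Lemma lift2_itv r w t : band r w -> 0 <= lift2 w t <= r.
Proof.
case=> cw wr; have c01 := @clamp_itv R 0 1 t ler01.
have E : prim01 w t = prim01 w (clamp01 t) by rewrite /prim01 (clamp_id c01).
have /andP[_ t1] := c01.
rewrite /lift2 subr_ge0 E prim01_le //=; last by move=> x _; case/andP: (wr x).
have /andP[_ h1] := prim01_itv 1 cw (fun x _ => wr x).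
by have /andP[h2 _] := prim01_itv (clamp01 t) cw (fun x _ => wr x); lra.
Qed.

Lemma lift1_itv r w t : band r w -> 0 <= lift1 w t <= r.
Proof.
move=> wb; apply: prim01_itv; first by apply: lift2_continuous; case: wb.
by move=> x _; exact: lift2_itv.
Qed.

Lemma lift0_itv r w t : band r w -> 0 <= lift0 w t <= r.
Proof.
move=> wb; apply: prim01_itv; first by apply: lift1_continuous; case: wb.
by move=> x _; exact: lift1_itv.
Qed.

Lemma lift0_derivative w : continuous w -> derivative01 (lift0 w) (lift1 w).
Proof. by move=> cw; apply: prim01_derivative01; exact: lift1_continuous. Qed.

Lemma lift1_derivative w : continuous w -> derivative01 (lift1 w) (lift2 w).
Proof. by move=> cw; apply: prim01_derivative01; exact: lift2_continuous. Qed.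

Lemma lift2_derivative w : continuous w -> derivative01 (lift2 w) (\- w).
Proof.
move=> cw; have cst0 : derivative01 (cst (prim01 w 1)) (cst 0 : R -> R).
  by apply: is_derive_derivative01 => t _; exact: is_derive_cst.
have := derivative01B cst0 (prim01_derivative01 cw).
by apply: eq_derivative01 => // t _ /=; rewrite sub0r.
Qed.

Lemma lift0_jet w t : continuous w -> 0 <= t <= 1 ->
  [/\ derive01n 1 (lift0 w) t = lift1 w t, derive01n 2 (lift0 w) t = lift2 w t,
    derive01n 3 (lift0 w) t = - w t &
    forall j, (j < 3)%N -> derivable01 (derive01n j (lift0 w)) t].
Proof.
move=> cw; exact: (derivative01_jet (lift0_derivative cw) (lift1_derivative cw)
  (lift2_derivative cw)).
Qed.

Lemma lift0_C3 w : continuous w -> C3 (lift0 w).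
Proof.
move=> cw; split=> [j t j3 t01|]; first by have [_ _ _] := lift0_jet cw t01; exact.
apply: (@subspace_eq_continuous _ _ _ (\- w)); last first.
  by apply: continuous_subspaceT => t; apply: cvgN; exact: cw.
move=> t /set_mem /=; rewrite in_itv /= => t01.
by have [_ _ e _] := lift0_jet cw t01; exact: (esym e).
Qed.

(** Each derivative of order at most 2 is dominated by the next one, so the norm is
    the maximum of [w], attained at 0. *)
Lemma lift0_sphere r w : 0 <= r -> band r w -> w 0 = r -> coneK_sphere r (lift0 w).
Proof.
move=> r0 wb w0; have [cw wr] := wb.
have le_r j t : (j < 4)%N -> 0 <= t <= 1 -> `|derive01n j (lift0 w) t| <= r.
  move=> j4 t01; have [e1 e2 e3 _] := lift0_jet cw t01.
  case: j j4 => [|[|[|[|//]]]] _; rewrite ?e1 ?e2 ?e3 ?normrN.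
  - by have /andP[? ?] := lift0_itv t wb; rewrite ger0_norm.
  - by have /andP[? ?] := lift1_itv t wb; rewrite ger0_norm.
  - by have /andP[? ?] := lift2_itv t wb; rewrite ger0_norm.
  - by have /andP[? ?] := wr t; rewrite ger0_norm.
have z01 : 0 <= (0 : R) <= 1 by rewrite lexx ler01.
split.
  split=> [|t t01]; first exact: lift0_C3.
  have [-> -> -> _] := lift0_jet cw t01; rewrite opprK.
  split; first by case/andP: (lift0_itv t wb).
  - by case/andP: (lift1_itv t wb).
  - by case/andP: (lift2_itv t wb).
  - by case/andP: (wr t).
apply/eqP; rewrite eq_le; apply/andP; split; first exact: norm3_le.
have := norm3_ge (fun t => @le_r 3%N t isT) z01.
by have [_ _ -> _] := lift0_jet cw z01; rewrite w0 normrN ger0_norm.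
Qed.

Lemma lift2_dist v w e t : continuous v -> continuous w ->
  (forall t, 0 <= t <= 1 -> `|v t - w t| <= e) -> `|lift2 v t - lift2 w t| <= e + e.
Proof.
move=> cv cw vw; have h1 := prim01_dist 1 cv cw vw; have h2 := prim01_dist t cv cw vw.
rewrite /lift2; have -> : prim01 v 1 - prim01 v t - (prim01 w 1 - prim01 w t) =
  (prim01 v 1 - prim01 w 1) - (prim01 v t - prim01 w t) by ring.
by rewrite (le_trans (ler_normB _ _)) // lerD.
Qed.

Lemma lift1_dist v w e t : continuous v -> continuous w ->
  (forall t, 0 <= t <= 1 -> `|v t - w t| <= e) -> `|lift1 v t - lift1 w t| <= e + e.
Proof.
by move=> cv cw vw; apply: prim01_dist => [||x _];
  [exact: lift2_continuous|exact: lift2_continuous|exact: lift2_dist].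
Qed.

Lemma lift0_dist v w e t : continuous v -> continuous w ->
  (forall t, 0 <= t <= 1 -> `|v t - w t| <= e) -> `|lift0 v t - lift0 w t| <= e + e.
Proof.
by move=> cv cw vw; apply: prim01_dist => [||x _];
  [exact: lift1_continuous|exact: lift1_continuous|exact: lift1_dist].
Qed.

Lemma lift0_norm3_dist v w e : continuous v -> continuous w -> 0 <= e ->
  (forall t, 0 <= t <= 1 -> `|v t - w t| <= e) ->
  norm3 (lift0 v \- lift0 w) <= e + e.
Proof.
move=> cv cw e0 vw; apply: norm3_le => [|j t j4 t01]; first exact: addr_ge0.
have [e1 e2 e3 _] := derivative01_jet
  (derivative01B (lift0_derivative cv) (lift0_derivative cw))
  (derivative01B (lift1_derivative cv) (lift1_derivative cw))
  (derivative01B (lift2_derivative cv) (lift2_derivative cw)) t01.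
case: j j4 => [|[|[|[|//]]]] _; rewrite ?e1 ?e2 ?e3.
- exact: lift0_dist.
- exact: lift1_dist.
- exact: lift2_dist.
- by rewrite /= -opprD normrN (le_trans (vw t t01)) // lerDl.
Qed.

End Jets.

Section Green.
Context {R : realType}.
Implicit Types (s t h lambda : R) (w phi : R -> R).
Notation mu := (@lebesgue_measure R).

Definition cubic (a b c d : R) s : R := a + b * s + c * s ^+ 2 + d * s ^+ 3.

Lemma is_derive_cubic (a b c d : R) s :
  is_derive s 1 (cubic a b c d) (b + 2 * c * s + 3 * d * s ^+ 2).
Proof.
have d1 := is_derive_id s (1 : R).
have dX2 := is_deriveX 2 d1; have dX3 := is_deriveX 3 d1.
have dC := is_deriveD (is_deriveD (is_deriveD (is_derive_cst a s 1)
  (is_deriveZ b d1)) (is_deriveZ c dX2)) (is_deriveZ d dX3).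
have E : cubic a b c d = cst a + (b \*: id) + (c \*: id ^+ 2) + (d \*: id ^+ 3).
  by apply/funext => x; rewrite /cubic !fctE.
rewrite E; apply: (is_derive_eq dC).
by rewrite /GRing.scale /=; ring.
Qed.

Lemma cubic_continuous (a b c d : R) : continuous (cubic a b c d).
Proof.
move=> s; have [ds _] := is_derive_cubic a b c d s.
by apply: differentiable_continuous; exact/derivable1_diffP.
Qed.

(** The two branches differ by a multiple of the cube of the positive part of
    [t - s]. *)
Lemma kernel_k_continuous t : continuous (kernel_k t).
Proof.
pose m s : R := Num.max 0 (t - s).
have cm : continuous m.
  apply: (@lip_continuous _ 1) => x y; rewrite mul1r /m.
  case: (leP 0 (t - x)) (leP 0 (t - y)) => hx [] hy.
  - by rewrite distrC (_ : _ - _ = x - y) //; ring.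
  - by rewrite subr0 ger0_norm // distrC; apply: le_trans (ler_norm _); lra.
  - by rewrite sub0r normrN ger0_norm //; apply: le_trans (ler_norm _); lra.
  - by rewrite subrr normr0.
have -> : kernel_k t = cubic (- t ^+ 3 / 6) (t ^+ 2 / 2) 0 0 \+ (cst 6^-1 \* (m \* (m \* m))).
  apply/funext => s; rewrite /kernel_k /cubic /m /=.
  case: leP => ts.
    by rewrite (max_idPl _) ?subr_le0 //; lra.
  by rewrite (max_idPr _) ?subr_ge0 ?ltW //; lra.
move=> s; apply: cvgD; first exact: cubic_continuous.
by apply: cvgM; [exact: cvg_cst|apply: cvgM; [exact: cm|apply: cvgM; exact: cm]].
Qed.

(** With [u = lift0 w], so that [u'''' = lambda * phi], an antiderivative of
    [k(t, s) u''''(s)] in [s] is [k u''' - k_s u'' + k_ss u' - k_sss u] on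
    either side of [s = t].  Its boundary terms at 0 and 1 are those of the
    boundary conditions, which leaves [u t] from the jump of [k_sss] at [t] and
    [gamma t * u'''(1)]. *)
Lemma green_identity w phi h lambda : continuous w -> continuous phi ->
  (forall t, 0 <= t <= 1 -> w t = lambda * (h + prim01 phi 1 - prim01 phi t)) ->
  forall t, 0 <= t <= 1 -> lift0 w t =
    lambda * (gamma t * h + \int[mu]_(s in `[0, 1]) (kernel_k t s * phi s)).
Proof.
move=> cw cphi wE t t01; have /andP[t0 t1] := t01.
(* [U], [U1], [U2], [U3] agree on [0, 1] with [u] and its derivatives, and are
   differentiable on both sides of the end points. *)
pose U := primitive (lift1 w); pose U1 := primitive (lift2 w).
pose U2 : R -> R := cst (primitive w 1) - primitive w.
pose U3 : R -> R := lambda *: (primitive phi - cst (h + primitive phi 1)).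
have o01 : 0 <= (1 : R) <= 1 by rewrite lexx ler01.
have U1E s : 0 <= s <= 1 -> U1 s = lift1 w s by move=> s01; rewrite /lift1 prim01E.
have U2E s : 0 <= s <= 1 -> U2 s = lift2 w s.
  by move=> s01; rewrite /lift2 !prim01E // /U2 !fctE.
have U3E s : 0 <= s <= 1 -> U3 s = - w s.
  move=> s01; rewrite wE // !prim01E // /U3 !fctE /GRing.scale /=; ring.
have dU s : 0 <= s <= 1 -> is_derive s 1 U (U1 s).
  by move=> s01; rewrite U1E //; apply: is_derive_primitive => //; exact: lift1_continuous.
have dU1 s : 0 <= s <= 1 -> is_derive s 1 U1 (U2 s).
  by move=> s01; rewrite U2E //; apply: is_derive_primitive => //; exact: lift2_continuous.
have dU2 s : 0 <= s <= 1 -> is_derive s 1 U2 (U3 s).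
  move=> s01; have dw := is_derive_primitive cw s01.
  by apply: is_derive_eq; rewrite U3E // sub0r.
have dU3 s : 0 <= s <= 1 -> is_derive s 1 U3 (lambda * phi s).
  move=> s01; have dw := is_derive_primitive cphi s01.
  by apply: is_derive_eq; rewrite subr0.
(* [A1] and [A2] are the branches [s <= t] and [t <= s] of the kernel, [G1] and
   [G2] the antiderivatives of their products with [U3'].  The other polynomials
   are the derivatives of the branches; [A2] is affine in [s], so [G2] stops
   after two terms. *)
pose A1 := cubic 0 0 (t / 2) (- 6^-1).
pose A2 := cubic (- t ^+ 3 / 6) (t ^+ 2 / 2) 0 0.
pose G1 : R -> R := A1 * U3 - cubic 0 t (- 2^-1) 0 * U2 + cubic t (-1) 0 0 * U1 + U.
pose G2 : R -> R := A2 * U3 - cubic (t ^+ 2 / 2) 0 0 0 * U2.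
have cA (A : R -> R) : continuous A -> continuous (fun s => A s * (lambda * phi s)).
  by move=> cc s; apply: cvgM; [exact: cc|apply: cvgM; [exact: cvg_cst|exact: cphi]].
have dG1 s : 0 <= s <= 1 -> is_derive s 1 G1 (A1 s * (lambda * phi s)).
  move=> s01.
  have p1 := is_derive_cubic 0 0 (t / 2) (- 6^-1) s.
  have p2 := is_derive_cubic 0 t (- 2^-1) 0 s.
  have p3 := is_derive_cubic t (-1) 0 0 s.
  apply: (is_derive_eq (is_deriveD (is_deriveD (is_deriveB (is_deriveM p1 (dU3 s s01))
    (is_deriveM p2 (dU2 s s01))) (is_deriveM p3 (dU1 s s01))) (dU s s01))).
  by rewrite /A1 /cubic /GRing.scale /=; lra.
have dG2 s : 0 <= s <= 1 -> is_derive s 1 G2 (A2 s * (lambda * phi s)).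
  move=> s01.
  have p1 := is_derive_cubic (- t ^+ 3 / 6) (t ^+ 2 / 2) 0 0 s.
  have p2 := is_derive_cubic (t ^+ 2 / 2) 0 0 0 s.
  apply: (is_derive_eq (is_deriveB (is_deriveM p1 (dU3 s s01)) (is_deriveM p2 (dU2 s s01)))).
  by rewrite /A2 /cubic /GRing.scale /=; lra.
have int01 : mu.-integrable `[0, 1] (EFin \o (fun s => kernel_k t s * phi s)).
  apply: continuous_integrable01; apply: continuous_subspaceT => s.
  by apply: cvgM; [exact: kernel_k_continuous|exact: cphi].
have int01l : mu.-integrable `[0, 1] (EFin \o (fun s => kernel_k t s * (lambda * phi s))).
  apply: continuous_integrable01; apply: continuous_subspaceT; apply: cA.
  exact: kernel_k_continuous.
rewrite mulrDr -RintegralZl //.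
have -> : \int[mu]_(s in `[0, 1]) (lambda * (kernel_k t s * phi s)) =
    \int[mu]_(s in `[0, 1]) (kernel_k t s * (lambda * phi s)).
  by apply: eq_Rintegral => s _; rewrite mulrCA.
have -> : \int[mu]_(s in `[0, 1]) (kernel_k t s * (lambda * phi s)) =
    (G1 t - G1 0) + (G2 1 - G2 t).
  have := @Rintegral_itvB R (fun s => kernel_k t s * (lambda * phi s)) (BLeft 0) (BRight 1) t int01l.
  rewrite !bnd_simp => /(_ t0 t1)/eqP; rewrite subr_eq => /eqP ->.
  rewrite Rintegral_itv_obnd_cbnd; last first.
    by apply: integrableS int01l => //; apply: subset_itvr; rewrite bnd_simp.
  rewrite -(FTC01 dG1 (cA _ (@cubic_continuous _ _ _ _)) (lexx 0) t0 t1).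
  rewrite -(FTC01 dG2 (cA _ (@cubic_continuous _ _ _ _)) t0 t1 (lexx 1)).
  rewrite addrC; congr (_ + _); apply: eq_Rintegral => s /set_mem /=; rewrite in_itv /=.
    case/andP=> s0 st; congr (_ * _); rewrite /kernel_k /A1 /cubic.
    by case: leP => [ts|_]; [have -> : s = t by apply/eqP; rewrite eq_le st|]; lra.
  by case/andP=> ts s1; congr (_ * _); rewrite /kernel_k /A2 /cubic ts; lra.
have -> : lift0 w t = U t by rewrite /lift0 prim01E.
have E0 : U2 1 = 0 by rewrite /U2 !fctE subrr.
have E1 : U3 1 = - (lambda * h) by rewrite /U3 !fctE /GRing.scale /=; ring.
have E2 : U 0 = 0 by exact: primitive0.
have E3 : U1 0 = 0 by exact: primitive0.
by rewrite /G1 /G2 !fctE E0 E1 E2 E3 /A1 /A2 /cubic /gamma; lra.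
Qed.

End Green.

(** * The normalized Hammerstein operator *)

Lemma heine_cantor (R : realType) (T : pseudoMetricType R) (K : set T) (g : T -> R) :
  compact K -> {within K, continuous g} -> forall e : R, 0 < e ->
  exists2 d : R, 0 < d & forall x y, K x -> K y -> ball x d y -> `|g x - g y| <= e.
Proof.
move=> /compact_near_coveringP/near_covering_withinP cK /subspace_continuousP cg e e0.
have e20 : 0 < e / 2 by lra.
pose P (d : R) x := forall y, K y -> ball x d y -> `|g x - g y| <= e.
have H x : K x -> \forall x' \near x & d \near 0^'+, K x' -> P d x'.
  move=> Kx; have /cvgrPdist_le/(_ _ e20)/nbhs_ballP[r /= r0 hr] := cg x Kx.
  have r20 : 0 < r / 2 by rewrite divr_gt0.
  exists (ball x (r / 2), [set d | d < r / 2]) => /=.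
    by split; [exact: nbhsx_ballx|exact: nbhs_right_lt].
  move=> [x' d] /= [xx' dr] Kx' y Ky x'y.
  have xy : ball x r y.
    rewrite [r]splitr; apply: ball_triangle xx' _.
    by apply: le_ball x'y; exact: ltW.
  have h1 := hr y xy Ky.
  have h2 : `|g x - g x'| <= e / 2.
    by apply: hr => //; apply: le_ball xx'; rewrite ler_pdivrMr // ler_pMr // ler1n.
  have -> : g x' - g y = (g x - g y) - (g x - g x') by ring.
  by rewrite (le_trans (ler_normB _ _)) // [leRHS]splitr lerD.
have near_d := cK _ _ P _ H.
have [d [d0 hd]] := filter_ex (@filterI _ (0^'+ : set_system R) _ _ _ (nbhs_right_gt 0) (near_d _)).
by exists d => // x y Kx Ky; exact: hd.
Qed.

Lemma dist_addB (R : realFieldType) (a a' b b' x x' e : R) :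
  `|a - a'| <= e / 3 -> `|b - b'| <= e / 3 -> `|x - x'| <= e / 3 ->
  `|a + b - x - (a' + b' - x')| <= e.
Proof.
rewrite !ler_norml => /andP[? ?] /andP[? ?] /andP[? ?].
by apply/andP; split; lra.
Qed.

Section Operator.
Context {R : realType}.
Variables (rho : R) (f : R * R * R * R * R -> R) (delta : R -> R)
  (H : (R -> R) -> R) (eta : R).
Hypotheses (rho_gt0 : 0 < rho)
  (f_cont : {within Pi_box rho, continuous f})
  (delta_cont : {within `[0, 1], continuous delta})
  (delta_ge0 : forall t : R, 0 <= t <= 1 -> 0 <= delta t)
  (f_ge : forall t u v w z : R,
     Pi_box rho (t, u, v, w, z) -> delta t <= f (t, u, v, w, z))
  (H_cont : norm3_continuous_on (coneK_ball rho) H)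
  (eta_ge0 : 0 <= eta)
  (H_ge : forall u : R -> R, coneK_sphere rho u -> eta <= H u)
  (pos : 0 < eta + \int[lebesgue_measure]_(s in `[0, 1]) delta s).
Implicit Types (s t e d : R) (v w : R -> R).

(** A retraction of [band rho] onto its members with value [rho] at 0, whose
    lifts are on the sphere. *)
Definition pin w t := clamp 0 rho (w t + rho - w 0).

Lemma pin_band w : band rho w -> band rho (pin w).
Proof.
case=> cw wr; split=> [t|t]; last by apply: clamp_itv; exact: ltW.
apply: (continuous_comp (f := fun s => w s + rho - w 0) (g := clamp 0 rho)).
  by apply: cvgB; [apply: cvgD; [exact: cw|exact: cvg_cst]|exact: cvg_cst].
by apply: clamp_continuous; exact: ltW.
Qed.

Lemma pin0 w : pin w 0 = rho.
Proof. by rewrite /pin addrAC subrr add0r clamp_id // lexx ltW. Qed.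

Lemma pin_id w : band rho w -> w 0 = rho -> pin w = w.
Proof.
case=> _ wr w0; apply/funext => t; rewrite /pin w0 addrK clamp_id //; exact: wr.
Qed.

Lemma pin_dist v w e : (forall t, 0 <= t <= 1 -> `|v t - w t| <= e) ->
  forall t, 0 <= t <= 1 -> `|pin v t - pin w t| <= e + e.
Proof.
move=> vw t t01; rewrite (le_trans (clamp_lip _ _ (ltW rho_gt0))) //.
have h0 := vw 0 (_ : 0 <= 0 <= 1); have ht := vw t t01.
have -> : v t + rho - v 0 - (w t + rho - w 0) = (v t - w t) - (v 0 - w 0) by ring.
by rewrite (le_trans (ler_normB _ _)) // lerD // h0 // lexx ler01.
Qed.

(** The arguments of [f] along [lift0 w], extended beyond [0, 1] so as to stay in
    the box. *)
Definition jet w s : R * R * R * R * R :=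
  (clamp01 s, lift0 w s, lift1 w s, lift2 w s, - w s).

Lemma jet_Pi w s : band rho w -> Pi_box rho (jet w s).
Proof.
move=> wb; have [_ wr] := wb; rewrite /Pi_box /jet /= !in_itv /=.
have h0 := lift0_itv s wb; have h1 := lift1_itv s wb; have h2 := lift2_itv s wb.
split=> //; last by rewrite lerN2 oppr_le0 andbC; exact: wr.
by do 3 (split=> //); exact: clamp_itv.
Qed.

Definition rhs w s : R := f (jet w s).

Lemma compact_Pi_box : compact (Pi_box rho).
Proof.
have sc := @segment_compact R.
exact: (compact_setX (compact_setX (compact_setX (compact_setX
  (sc 0 1) (sc 0 rho)) (sc 0 rho)) (sc 0 rho)) (sc (- rho) 0)).
Qed.

Lemma f_unif e : 0 < e -> exists2 d : R, 0 < d & forall t u v w z t' u' v' w' z' : R,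
  Pi_box rho (t, u, v, w, z) -> Pi_box rho (t', u', v', w', z') ->
  [/\ `|t - t'| < d, `|u - u'| < d, `|v - v'| < d, `|w - w'| < d & `|z - z'| < d] ->
  `|f (t, u, v, w, z) - f (t', u', v', w', z')| <= e.
Proof.
move=> e0; have [d d0 hd] := heine_cantor compact_Pi_box f_cont e0.
exists d => // t u v w z t' u' v' w' z' P P' [? ? ? ? ?]; exact: hd.
Qed.

Lemma rhs_continuous w : band rho w -> continuous (rhs w).
Proof.
move=> wb s; have [cw _] := wb; apply/cvgrPdist_le => e e0.
have [d d0 hd] := f_unif e0.
have cont (g : R -> R) : continuous g -> \forall x \near s, `|g s - g x| < d.
  by move=> cg; have /cvgrPdist_lt := cg s; exact.
near=> x; apply: hd; [exact: jet_Pi|exact: jet_Pi|split].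
- by near: x; apply: cont; exact: clamp_continuous.
- by near: x; apply: cont; exact: lift0_continuous.
- by near: x; apply: cont; exact: lift1_continuous.
- by near: x; apply: cont; exact: lift2_continuous.
- by near: x; apply: (cont (\- w)) => y; apply: cvgN; exact: cw.
Unshelve. all: by end_near. Qed.

Lemma rhs_near e : 0 < e -> exists2 d : R, 0 < d & forall v w, band rho v -> band rho w ->
  (forall t, 0 <= t <= 1 -> `|v t - w t| <= d) ->
  forall s, 0 <= s <= 1 -> `|rhs v s - rhs w s| <= e.
Proof.
move=> e0; have [d d0 hd] := f_unif e0; exists (d / 3); first by lra.
move=> v w vb wb vw s s01; have [cv _] := vb; have [cw _] := wb.
have dd : d / 3 + d / 3 < d by lra.
apply: hd; [exact: jet_Pi|exact: jet_Pi|split].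
- by rewrite subrr normr0.
- exact: le_lt_trans (lift0_dist s cv cw vw) dd.
- exact: le_lt_trans (lift1_dist s cv cw vw) dd.
- exact: le_lt_trans (lift2_dist s cv cw vw) dd.
- by rewrite -opprD normrN (le_lt_trans (vw s s01)) //; lra.
Qed.

Lemma rhs_ge w s : band rho w -> 0 <= s <= 1 -> delta s <= rhs w s.
Proof. by move=> wb s01; rewrite -{1}(clamp_id s01); exact: f_ge (jet_Pi s wb). Qed.

Lemma rhs_bounded : exists2 M : R, 0 <= M & forall w s, band rho w -> 0 <= s <= 1 ->
  `|rhs w s| <= M.
Proof.
have band0 : band rho (cst 0).
  by split=> [|t]; [exact: cst_continuous|rewrite lexx ltW].
have P0 : Pi_box rho !=set0 by exists (jet (cst 0) 0); exact: jet_Pi.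
have [c _ hc] := compact_EVT_max P0 compact_Pi_box f_cont.
have rhs_le w s : band rho w -> rhs w s <= f c.
  by move=> wb; apply: hc; apply/mem_set; exact: jet_Pi.
have rhs_ge0 w s : band rho w -> 0 <= s <= 1 -> 0 <= rhs w s.
  by move=> wb s01; rewrite (le_trans (delta_ge0 s01)) // rhs_ge.
exists (f c) => [|w s wb s01]; last by rewrite ger0_norm ?rhs_le ?rhs_ge0.
have z01 : 0 <= (0 : R) <= 1 by rewrite lexx ler01.
exact: le_trans (rhs_ge0 _ _ band0 z01) (rhs_le _ 0 band0).
Qed.

(** [H u + \int_t^1 f(s, u, u', u'', u''') ds] for [u = lift0 w]. *)
Definition load w t : R := H (lift0 w) + prim01 (rhs w) 1 - prim01 (rhs w) t.

Let c : R := eta + \int[lebesgue_measure]_(s in `[0, 1]) delta s.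

Lemma load0_ge w : band rho w -> w 0 = rho -> c <= load w 0.
Proof.
move=> wb w0; have cr := rhs_continuous wb.
have o01 : 0 <= (1 : R) <= 1 by rewrite lexx ler01.
rewrite /load /c prim01_0 subr0 lerD //; first by apply: H_ge; apply: lift0_sphere => //; exact: ltW.
have -> : prim01 (rhs w) 1 = \int[lebesgue_measure]_(s in `[0, 1]) rhs w s.
  have dP (x : R) : 0 <= x <= 1 -> is_derive x 1 (primitive (rhs w)) (rhs w x).
    exact: is_derive_primitive.
  by rewrite (FTC01 dP cr (lexx 0) ler01 (lexx 1)) primitive0 subr0 prim01E.
apply: le_Rintegral => //.
- exact: continuous_integrable01.
- by apply: continuous_integrable01; exact: continuous_subspaceT.
- by move=> x /=; rewrite in_itv /=; exact: rhs_ge.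
Qed.

Lemma load_itv w t : band rho w -> w 0 = rho -> 0 <= t <= 1 -> 0 <= load w t <= load w 0.
Proof.
move=> wb w0 /andP[t0 t1]; have cr := rhs_continuous wb.
have r0 x : 0 <= x <= 1 -> 0 <= rhs w x.
  by move=> x01; rewrite (le_trans (delta_ge0 x01)) // rhs_ge.
have h1 := prim01_le cr r0 t0; have h2 := prim01_le cr r0 t1.
have h3 : eta <= H (lift0 w) by apply: H_ge; apply: lift0_sphere => //; exact: ltW.
have h4 := le_trans eta_ge0 h3.
apply/andP; split; first by rewrite /load -addrA addr_ge0 // subr_ge0.
by rewrite /load lerD2l lerN2.
Qed.

Lemma load_lip (M : R) w s t : band rho w ->
  (forall s, 0 <= s <= 1 -> `|rhs w s| <= M) -> `|load w s - load w t| <= M * `|s - t|.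
Proof.
move=> wb wM; rewrite distrC [`|s - t|]distrC.
have -> : load w t - load w s = - (prim01 (rhs w) t - prim01 (rhs w) s).
  by rewrite /load; ring.
by rewrite normrN; apply: prim01_lip => //; exact: rhs_continuous.
Qed.

(** Continuity for the sup norm on [0, 1]: closeness of the third derivatives
    makes the lifts close in the norm of [H], and the integrands uniformly
    close. *)
Lemma load_near w e : band rho w -> w 0 = rho -> 0 < e -> exists2 d : R, 0 < d &
  forall v, band rho v -> v 0 = rho ->
  (forall t, 0 <= t <= 1 -> `|v t - w t| <= d) ->
  forall t, `|load v t - load w t| <= e.
Proof.
move=> wb w0 e0; have e30 : 0 < e / 3 by lra.
have ball_lift v : band rho v -> v 0 = rho -> coneK_ball rho (lift0 v).
  move=> vb v0; have [vK vn] := lift0_sphere (ltW rho_gt0) vb v0.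
  by split=> //; rewrite vn.
have [d1 d10 hd1] := H_cont (ball_lift w wb w0) e30.
have [d2 d20 hd2] := rhs_near e30.
exists (Num.min (d1 / 3) d2) => [|v vb v0 vw t]; first by rewrite lt_min d20 andbT; lra.
have vw1 x : 0 <= x <= 1 -> `|v x - w x| <= d1 / 3.
  by move=> /vw; rewrite le_min => /andP[].
have vw2 x : 0 <= x <= 1 -> `|v x - w x| <= d2.
  by move=> /vw; rewrite le_min => /andP[].
have [cv _] := vb; have [cw _] := wb.
have hH : `|H (lift0 v) - H (lift0 w)| < e / 3.
  apply: hd1; first exact: ball_lift.
  by apply: le_lt_trans (lift0_norm3_dist cv cw _ vw1) _; lra.
have hr := hd2 v w vb wb vw2.
have p1 := prim01_dist 1 (rhs_continuous vb) (rhs_continuous wb) hr.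
have p2 := prim01_dist t (rhs_continuous vb) (rhs_continuous wb) hr.
exact: (dist_addB (ltW hH) p1 p2).
Qed.

Definition step w t : R := rho * load (pin w) t / load (pin w) 0.

(** The denominators are at least [c = eta + \int delta > 0], which gives the
    common Lipschitz constant [rho * M / c] when [M] bounds [f] along the jets,
    and the continuity of the quotient. *)
Lemma step_fixed_point : exists2 w, band rho w & forall t, 0 <= t <= 1 -> step w t = w t.
Proof.
have [M M0 hM] := rhs_bounded.
have c_gt0 : 0 < c by exact: pos.
have load_gt0 w : band rho w -> 0 < load (pin w) 0.
  by move=> wb; apply: lt_le_trans c_gt0 (load0_ge (pin_band wb) (pin0 w)).
apply: (@schauder_fixed_point R rho (rho * M / c) step) => //.
- by rewrite divr_ge0 ?mulr_ge0 // ltW.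
- move=> w wb t t01; have /andP[l0 l1] := load_itv (pin_band wb) (pin0 w) t01.
  have lp := load_gt0 w wb.
  rewrite /step divr_ge0 ?mulr_ge0 ?(ltW rho_gt0) ?(ltW lp) //=.
  by rewrite ler_pdivrMr // ler_pM2l.
- move=> w wb s t s01 t01; have lp := load_gt0 w wb.
  have pb := pin_band wb; have cl := load0_ge pb (pin0 w).
  rewrite /step -mulrBl -mulrBr !normrM (gtr0_norm rho_gt0) normfV (gtr0_norm lp).
  have h := load_lip s t pb (fun x => hM _ x pb).
  rewrite ler_pdivrMr // mulrAC -!mulrA ler_pM2l // (le_trans h) //.
  rewrite [X in _ <= _ * X]mulrC -mulrA ler_wpM2l //.
  rewrite mulrCA ler_peMr // ler_pdivlMr // mul1r //.
move=> w wb e e0; have pb := pin_band wb; have lp := load_gt0 w wb.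
have cl := load0_ge pb (pin0 w).
(* The denominators are at least [c] and [load t <= load 0], so each of the
   numerator and the denominator may contribute [e / 2] to the error. *)
have e10 : 0 < e * c / (2 * rho) by rewrite divr_gt0 ?mulr_gt0.
have [d d0 hd] := load_near pb (pin0 w) e10.
exists (d / 2) => [|v vb vw t t01]; first by lra.
have pbv := pin_band vb; have lpv := load_gt0 v vb.
have clv := load0_ge pbv (pin0 v).
have pvw : forall t, 0 <= t <= 1 -> `|pin v t - pin w t| <= d.
  by move=> x x01; have := pin_dist vw x01; rewrite -splitr.
have n1 := hd _ pbv (pin0 v) pvw t; have n2 := hd _ pbv (pin0 v) pvw 0.
have /andP[lt0 lt1] := load_itv pb (pin0 w) t01.
rewrite /step; move: n1 n2.
set Nv := load (pin v) t; set N := load (pin w) t in lt0 lt1 *.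
set Av := load (pin v) 0 in lpv clv *; set A := load (pin w) 0 in lp cl lt1 *.
move=> n1 n2.
have -> : rho * Nv / Av - rho * N / A = rho / Av * ((Nv - N) - N / A * (Av - A)).
  by field; rewrite !gt_eqF.
rewrite normrM gtr0_norm ?divr_gt0 //.
have NA : `|N / A| <= 1 by rewrite ger0_norm ?divr_ge0 ?(ltW lp) // ler_pdivrMr // mul1r.
have h : `|(Nv - N) - N / A * (Av - A)| <= e * c / rho.
  apply: le_trans (ler_normB _ _) _; rewrite normrM.
  have -> : e * c / rho = e * c / (2 * rho) + e * c / (2 * rho).
    by field; rewrite gt_eqF.
  by apply: lerD => //; apply: le_trans n2; rewrite ler_piMl.
apply: le_trans (ler_wpM2l _ h) _; first by rewrite divr_ge0 ?ltW.
have -> : rho / Av * (e * c / rho) = e * (c / Av) by field; rewrite !gt_eqF.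
by rewrite ler_piMr ?(ltW e0) // ler_pdivrMr // mul1r.
Qed.

Lemma eigenpair_exists : exists lambda u,
  [/\ 0 < lambda, coneK_sphere rho u & bvp_eigenpair f H lambda u].
Proof.
have [w wb wE] := step_fixed_point.
have c_gt0 : 0 < c by exact: pos.
have lp : 0 < load (pin w) 0 by exact: lt_le_trans c_gt0 (load0_ge (pin_band wb) (pin0 w)).
have w0 : w 0 = rho by rewrite -wE ?lexx ?ler01 // /step mulfK // gt_eqF.
rewrite pin_id // in lp; have [cw _] := wb.
have sph := lift0_sphere (ltW rho_gt0) wb w0.
exists (rho / load w 0), (lift0 w); split=> //; first by rewrite divr_gt0.
split; [exact: lift0_C3|by case: sph => _ ->|move=> t t01].
have -> : \int[lebesgue_measure]_(s in `[0, 1]) (kernel_k t s *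
    f (s, lift0 w s, derive01n 1 (lift0 w) s, derive01n 2 (lift0 w) s,
       derive01n 3 (lift0 w) s)) =
    \int[lebesgue_measure]_(s in `[0, 1]) (kernel_k t s * rhs w s).
  apply: eq_Rintegral => s /set_mem /=; rewrite in_itv /= => s01.
  have [e1 e2 e3 _] := lift0_jet cw s01.
  by congr (_ * f _); rewrite /jet clamp_id // -e1 -e2 -e3.
apply: (green_identity cw (rhs_continuous wb)) => // s s01.
by rewrite -[LHS]wE // /step pin_id // mulrAC.
Qed.

End Operator.

Theorem theorem2p3 (R : realType) (rho : R) (rho_gt0 : 0 < rho)
  (f : R * R * R * R * R -> R) (delta : R -> R)
  (H : (R -> R) -> R) (eta : R)
  (f_cont : {within Pi_box rho, continuous f})
  (delta_cont : {within `[0, 1], continuous delta})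
  (delta_ge0 : forall t : R, 0 <= t <= 1 -> 0 <= delta t)
  (f_ge : forall t u v w z : R,
     Pi_box rho (t, u, v, w, z) -> delta t <= f (t, u, v, w, z))
  (H_cont : norm3_continuous_on (coneK_ball rho) H)
  (H_bnd : bounded_functional_on (coneK_ball rho) H)
  (eta_ge0 : 0 <= eta)
  (H_ge : forall u : R -> R, coneK_sphere rho u -> eta <= H u)
  (pos : 0 < eta + \int[lebesgue_measure]_(s in `[0, 1]) delta s) :
  exists (lambda_rho : R) (u_rho : R -> R),
    [/\ 0 < lambda_rho, coneK_sphere rho u_rho
      & bvp_eigenpair f H lambda_rho u_rho].
Proof.
exact: (eigenpair_exists rho_gt0 f_cont delta_cont delta_ge0 f_ge H_cont eta_ge0
  H_ge pos).
Qed.
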